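(* Let $M$ be a smooth $3$-manifold, let $\beta$ be a given (smooth) time-dependent spatial shift vector on $M\times\mathbb{R}$, and let $F$ be a given smooth function of the spacetime point, $N$, $\bar g$, $K$ and the first derivatives of $N$. With the notation of the context, consider the system for the unknowns $(\bar g,K,N)$, where $\bar g=(g_{ij})$ is a properly Riemannian spatial metric, $K=(K_{ij})$ a symmetric spatial tensor and $N>0$ the lapse: $$\hat\partial_0g_{ij}=-2NK_{ij},$$ $$\hat\partial_0\hat\Box K_{ij}=f_{ij},$$ $$\hat\partial_0\hat\Box N=\hat\partial_0F,$$ where the second equation is the equation $\Lambda_{ij}=0$ reduced by the substitution $\hat\Box N=F$ and by the replacement of $\hat\partial_0g_{ij}$ by $-2NK_{ij}$ wherever it occurs (so that $f_{ij}$ contains derivatives of order at most $2$ of $\bar g$ and $K$ and at most $3$ of $N$), and in the third equation $\hat\partial_0g_{ij}$ is likewise replaced by $-2NK_{ij}$. Then this system is a quasi-diagonal hyperbolic system.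
   Context: Setting. $M$ is a smooth $3$-manifold with local coordinates $x^i$; spacetime is $M\times\mathbb{R}$ with $x^0=t$, with metric $ds^2=-N^2(\theta^0)^2+g_{ij}\theta^i\theta^j$, $\theta^0=dt$, $\theta^i=dx^i+\beta^idt$. $\bar g=g_{ij}dx^idx^j$ is the metric of the slice $M_t=M\times\{t\}$, $\bar\nabla$ its Levi-Civita connection, $\bar R_{ij}$, $\bar R_{kijm}$ its Ricci and Riemann tensors, with convention $[\bar\nabla_a,\bar\nabla_b]V^c=\bar R^c{}_{dab}V^d$, $\bar R_{db}=\bar R^c{}_{dcb}$. Spatial indices are moved with $\bar g$; $H=K^k{}_k$; $A_{(ij)}=\frac12(A_{ij}+A_{ji})$. The operator $\hat\partial_0=\partial_t-\mathcal L_\beta$ acts on time-dependent spatial tensors, $\mathcal L_\beta$ being the Lie derivative along $\beta$. Define $$\hat\Box=-N^{-1}\hat\partial_0N^{-1}\hat\partial_0+\bar\nabla^k\bar\nabla_k,$$ so that $\hat\Box N=-N^{-1}\hat\partial_0(N^{-1}\hat\partial_0N)+\bar\nabla^k\bar\nabla_kN$. The tensor $\Lambda_{ij}$ is $$\Lambda_{ij}=\hat\partial_0(N\hat\Box K_{ij})+\hat\partial_0J_{ij}+\bar\nabla_i\bar\nabla_j\big(N\hat\Box N-N^2K^{mk}K_{mk}\big)+\mathcal C_{ij},$$ where $$\begin{aligned}J_{ij}={}&\hat\partial_0(HK_{ij}-2K_i{}^kK_{jk})+(N^{-2}\hat\partial_0N+H)\bar\nabla_i\bar\nabla_jN-2N^{-1}(\bar\nabla_kN)\bar\nabla_{(i}(NK^k{}_{j)})\\&+3(\bar\nabla^kN)\bar\nabla_kK_{ij}+N^{-1}K_{ij}\bar\nabla^k(N\bar\nabla_kN)-2\bar\nabla_{(i}(K_{j)}{}^k\bar\nabla_kN)+N^{-1}H\bar\nabla_i\bar\nabla_jN^2\\&+2N^{-1}(\bar\nabla_{(i}H)(\bar\nabla_{j)}N^2)-2NK^k{}_{(i}\bar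 R_{j)k}-2N\bar R_{kijm}K^{km},\end{aligned}$$ $$\mathcal C_{ij}=\bar\nabla_i\bar\nabla_j\big(\hat\partial_0(N^{-1}\hat\partial_0N)+N\hat\partial_0H\big)-\hat\partial_0\big(N^{-1}\bar\nabla_i\bar\nabla_j(\hat\partial_0N+N^2H)\big).$$ (When $\hat\partial_0g_{ij}=-2NK_{ij}$ this equals $\hat\partial_0\hat\partial_0R_{ij}-2\hat\partial_0\bar\nabla_{(i}R_{j)0}+\bar\nabla_i\bar\nabla_jR_{00}$, with $R_{\alpha\beta}$ the spacetime Ricci components in the frame dual to $\theta^\alpha$.) Thus $$f_{ij}=-N^{-1}\Big[(\hat\partial_0N)\hat\Box K_{ij}+\hat\partial_0J_{ij}+\bar\nabla_i\bar\nabla_j\big(NF-N^2K^{mk}K_{mk}\big)+\mathcal C_{ij}\Big],$$ with $\hat\partial_0g_{ij}$ replaced by $-2NK_{ij}$. Quasi-diagonal hyperbolic system (Leray). One can assign integers (Leray--Volevich indices) $m_k$ to the unknowns $u_k$ and $n_j$ to the equations such that equation $j$ has order at most $m_k-n_j$ in $u_k$ (an equation with $m_k-n_j<0$ not containing $u_k$), and such that the principal matrix, formed by the terms of order exactly $m_k-n_j$, is diagonal, with diagonal entries that are (strictly) hyperbolic operators whose hyperbolicity cones have a nonempty common open part, and with coefficients depending on each unknown $u_k$ only through derivatives of order lower than $m_k-n_j$, where $j$ is the equation in which the entry occurs. A scalar operator with principal symbol $a(x,\xi)$ of degree $m$ is strictly hyperbolic at $x$ if there is a nonempty open convex cone of covectors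 $\tau$ such that for every $\xi$ not proportional to $\tau$ the polynomial $\lambda\mapsto a(x,\xi+\lambda\tau)$ has $m$ distinct real roots. *)

(* Defs.v *)
From HB Require Import structures.
From mathcomp Require Import all_boot all_order all_algebra.
From mathcomp Require Import all_classical all_reals all_analysis.
Set Implicit Arguments.
Unset Strict Implicit.
Unset Printing Implicit Defensive.
Import Order.TTheory GRing.Theory Num.Theory.
Import numFieldNormedType.Exports.
Local Open Scope classical_set_scope.
Local Open Scope ring_scope.

(* Spacetime indices are 'I_4 with ord0 the time index; spatial indices are
   'I_3, embedded by [sp]. *)
Definition sp (i : 'I_3) : 'I_4 := lift ord0 i.
Definition spat (R : realType) (x : 'rV[R]_4) : 'rV[R]_3 := \row_i x 0 (sp i).

(* C^infinity on an open subset A of a finite-dimensional V: every iterated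
   directional derivative is Frechet differentiable at every point of A. *)
Definition smooth_on (R : realType) (V : normedModType R)
    (A : set V) (f : V -> R) : Prop :=
  forall (l : seq V) (x : V), A x ->
    differentiable (foldr (fun v h => 'D_v h) f l) x.

(* [param c] is the inverse of the coordinate map [coord c] on the image of the
   chart domain; outside that image its values are irrelevant. *)
Record manifold3 (R : realType) := Manifold3 {
  carrier :> topologicalType;
  chart : Type;
  dom : chart -> set carrier;
  coord : chart -> carrier -> 'rV[R]_3;
  param : chart -> 'rV[R]_3 -> carrier;
  manifold_hausdorff : hausdorff_space carrier;
  manifold_second_countable : @second_countable carrier;
  dom_open : forall c, open (dom c);
  dom_cover : forall p : carrier, exists c, dom c p;
  coord_open : forall c, open (coord c @` dom c);
  coordK : forall c p, dom c p -> param c (coord c p) = p;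
  coord_continuous : forall c, {within dom c, continuous (coord c)};
  param_continuous : forall c, {within coord c @` dom c, continuous (param c)};
  transition_smooth : forall (c d : chart) (k : 'I_3),
    smooth_on (coord c @` (dom c `&` dom d))
      (fun x : 'rV[R]_3 => (coord d (param c x)) 0 k)
}.

Section Manifold.
Context {R : realType}.
Implicit Types M : manifold3 R.

Definition spatial_image M (c : chart M) : set 'rV[R]_3 := coord c @` dom c.

Definition overlap M (c d : chart M) : set 'rV[R]_3 :=
  coord c @` (dom c `&` dom d).

Definition transition M (c d : chart M) (x : 'rV[R]_3) : 'rV[R]_3 :=
  coord d (param c x).

(* the change of coordinates (t, x) |-> (t, transition x) of M x R *)
Definition st_transition M (c d : chart M) (x : 'rV[R]_4) : 'rV[R]_4 :=
  \row_mu (if unlift ord0 mu is Some i then transition c d (spat x) 0 i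
           else x 0 ord0).

(* A smooth time-dependent spatial vector field on M x R, given by its
   components (as row vectors) in each chart. With the row convention of the
   library, ('J f x) i k = d f^k / d x^i. *)
Definition smooth_shift M (beta : chart M -> 'rV[R]_4 -> 'rV[R]_3) : Prop :=
  (forall c k, smooth_on [set x : 'rV[R]_4 | spatial_image c (spat x)]
                         (fun x => beta c x 0 k))
  /\ (forall c d x, overlap c d (spat x) ->
        beta d (st_transition c d x)
        = beta c x *m 'J (transition c d) (spat x)).

(* For non-symmetric g this says that the symmetric part of g is positive
   definite. *)
Definition posdef (g : 'M[R]_3) : Prop :=
  forall v : 'rV[R]_3, v != 0 -> 0 < (v *m g *m v^T) 0 0.

(* (spacetime point, N, (g_ij), (K_ij), (d_mu N)) *)
Definition source_arg : Type :=
  ('rV[R]_4 * R * 'M[R]_3 * 'M[R]_3 * 'rV[R]_4)%type.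

(* A smooth function of the spacetime point, N, g, K and the first derivatives
   of N: its expression in each chart is smooth, and the expressions in two
   charts agree under the tensorial change of (g, K, dN). The local expressions
   take arbitrary matrices as arguments, but are only ever used on symmetric
   ones; a smooth function of the symmetric g and K extends to the domain below
   by composition with the symmetric part. *)
Definition smooth_source M (F : chart M -> source_arg -> R) : Prop :=
  (forall c, smooth_on
     [set a : source_arg | let: (x, N, g, K, q) := a in
        [/\ spatial_image c (spat x), 0 < N & posdef g]] (F c))
  /\ (forall c d x N (g K : 'M[R]_3) (q : 'rV[R]_4),
        overlap c d (spat x) -> 0 < N -> posdef g -> g^T = g -> K^T = K ->
        let J := 'J (transition c d) (spat x) in
        F c (x, N, J *m g *m J^T, J *m K *m J^T,
             q *m ('J (st_transition c d) x)^T)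
        = F d (st_transition c d x, N, g, K, q)).

End Manifold.

Definition midx : Type := {ffun 'I_4 -> nat}.
Definition mdeg (a : midx) : nat := (\sum_i a i)%N.
Definition mincr (i : 'I_4) (a : midx) : midx := [ffun j => (a j + (i == j))%N].
Definition midx0 : midx := [ffun=> 0%N].

Section Jets.
Variables (R : realType) (U : finType).

(* A point of the (infinite) jet space: a spacetime point in coordinates and
   values for all derivatives of the unknowns indexed by U. An equation of a
   system of partial differential equations is a function on jet space. *)
Definition jet : Type := ('rV[R]_4 * (U -> midx -> R))%type.
Definition jfun : Type := jet -> R.

Definition jvar (u : U) (a : midx) : jfun := fun z => z.2 u a.

(* Derivative along the vector field of jet space whose component on the
   spacetime coordinate c is 1 and whose jet components are v. *)
Definition jderive (c : 'I_4) (v : U -> midx -> jfun) (P : jfun) : jfun :=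
  fun z => derive1 (fun s : R => P (z.1 + s *: delta_mx 0 c,
                                    fun u a => z.2 u a + s * v u a z)) 0.

(* The total derivative with respect to the coordinate c. *)
Definition Dtot (c : 'I_4) (P : jfun) : jfun :=
  jderive c (fun u a => jvar u (mincr c a)) P.

Definition Dmulti (a : midx) (P : jfun) : jfun :=
  foldr (fun c Q => iter (a c) (Dtot c) Q) P (enum 'I_4).

Definition order_at_most (A : set jet) (r : U -> nat) (P : jfun) : Prop :=
  forall z z', A z -> A z' -> z.1 = z'.1 ->
    (forall u a, (mdeg a <= r u)%N -> z.2 u a = z'.2 u a) -> P z = P z'.

(* \sum over the multi-indices a of length exactly d; empty if d < 0 *)
Definition sum_deg (d : int) (f : midx -> R) : R :=
  \sum_(a : {ffun 'I_4 -> 'I_(absz d).+1} |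
          (mdeg [ffun i => nat_of_ord (a i)])%:Z == d)
     f [ffun i => nat_of_ord (a i)].

Definition symbol (d : int) (a : midx -> R) (xi : 'rV[R]_4) : R :=
  sum_deg d (fun al => a al * \prod_i xi 0 i ^+ al i).

(* C is a nonempty open convex cone of covectors with respect to which the
   symbol p of degree d is strictly hyperbolic. Since lambda |-> p(xi + lambda
   tau) is a polynomial of degree at most d, it has d distinct real roots iff
   its zero set has exactly d elements (or it vanishes identically, which is
   excluded here). *)
Definition strict_hyperbolicity_cone (d : int) (p : 'rV[R]_4 -> R)
    (C : set 'rV[R]_4) : Prop :=
  [/\ C !=set0, open C, @convex_set R 'rV[R]_4 C,
      (forall s tau, 0 < s -> C tau -> C (s *: tau)) &
      forall tau, C tau -> forall xi, (forall s, xi <> s *: tau) ->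
        exists rs : seq R, [/\ uniq rs, (size rs)%:Z = d &
          forall lambda, (p (xi + lambda *: tau) = 0) <-> (lambda \in rs)]].

Definition lower_order (A : set jet) (d : U -> int) (P : jfun) : Prop :=
  forall z z', A z -> A z' -> z.1 = z'.1 ->
    (forall u a, (mdeg a)%:Z < d u -> z.2 u a = z'.2 u a) -> P z = P z'.

(* The square system E e = 0 (e : U), on the set A of jets, with indices m of
   the unknowns and n of the equations. [a e u al] is the coefficient of
   d^al u in the equation e for |al| = m u - n e, and [b e] collects the terms
   of lower order; both are determined by E. In particular the equation e has
   order at most m u - n e in u, and does not contain u if m u < n e. *)
Definition quasi_diagonal_with (m n : U -> int) (A : set jet)
    (E : U -> jfun) : Prop :=
  exists (a : U -> U -> midx -> jfun) (b : U -> jfun),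
  [/\ forall e z, A z ->
        E e z = \sum_u sum_deg (m u - n e) (fun al => a e u al z * jvar u al z)
                + b e z,
      forall e u al, (mdeg al)%:Z = m u - n e ->
        lower_order A (fun u' => m u' - n e) (a e u al),
      forall e, lower_order A (fun u' => m u' - n e) (b e),
      forall e u al z, e != u -> (mdeg al)%:Z = m u - n e ->
        A z -> a e u al z = 0 &
      forall z, A z -> exists (C : U -> set 'rV[R]_4) (O : set 'rV[R]_4),
        [/\ forall u, strict_hyperbolicity_cone (m u - n u)
                        (symbol (m u - n u) (fun al => a u u al z)) (C u),
            O !=set0, open O & forall u, O `<=` C u]].

(* A system given by its expression in each chart c : I. *)
Definition quasi_diagonal_hyperbolic (I : Type) (A : I -> set jet)
    (E : I -> U -> jfun) : Prop :=
  exists m n : U -> int, forall c, quasi_diagonal_with m n (A c) (E c).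

End Jets.

(* The independent components ij, i <= j, of a symmetric tensor. *)
Definition sym_idx : Type := {p : 'I_3 * 'I_3 | (p.1 <= p.2)%N}.
Definition sidx (i j : 'I_3) : sym_idx :=
  insubd (exist _ (ord0, ord0) isT : sym_idx)
         (if (i <= j)%N then (i, j) else (j, i)).

Definition unknown : Type := (sym_idx + sym_idx + unit)%type.
Definition Ug (p : sym_idx) : unknown := inl (inl p).
Definition UK (p : sym_idx) : unknown := inl (inr p).
Definition UN : unknown := inr tt.

Section System.
Variable R : realType.

Definition jf : Type := jfun R unknown.
Definition tensor1 : Type := 'I_3 -> jf.
Definition tensor2 : Type := 'I_3 -> 'I_3 -> jf.
Definition tensor3 : Type := 'I_3 -> 'I_3 -> 'I_3 -> jf.

Definition gd : tensor2 := fun i j => jvar (Ug (sidx i j)) midx0.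
Definition Kd : tensor2 := fun i j => jvar (UK (sidx i j)) midx0.
Definition N : jf := jvar UN midx0.
Definition Ninv : jf := fun z => (N z)^-1.

Definition gmx (z : jet R unknown) : 'M[R]_3 := \matrix_(i, j) gd i j z.
Definition Kmx (z : jet R unknown) : 'M[R]_3 := \matrix_(i, j) Kd i j z.
Definition gu : tensor2 := fun i j z => invmx (gmx z) i j.

Definition sym (T : tensor2) : tensor2 :=
  fun i j => 2^-1 *: (T i j + T j i).

(* Only total derivatives in the spatial directions enter the geometry of the
   slices. *)
Definition Ds (i : 'I_3) (P : jf) : jf := Dtot (sp i) P.

(* Gam k i j = Gamma^k_ij *)
Definition Gam : tensor3 := fun k i j =>
  2^-1 *: \sum_l gu k l * (Ds i (gd j l) + Ds j (gd i l) - Ds l (gd i j)).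

(* In all covariant derivatives the first index is that of the derivative. *)
Definition cov0 (P : jf) : tensor1 := fun c => Ds c P.
Definition cov1 (V : tensor1) : tensor2 := fun c i =>
  Ds c (V i) - \sum_d Gam d c i * V d.
Definition cov2 (T : tensor2) : tensor3 := fun c i j =>
  Ds c (T i j) - \sum_d Gam d c i * T d j - \sum_d Gam d c j * T i d.
Definition cov3 (T : tensor3) : 'I_3 -> tensor3 := fun c i j k =>
  Ds c (T i j k) - \sum_d Gam d c i * T d j k - \sum_d Gam d c j * T i d k
  - \sum_d Gam d c k * T i j d.
(* for T k j = T^k_j *)
Definition cov11 (T : tensor2) : tensor3 := fun c k j =>
  Ds c (T k j) + \sum_d Gam k c d * T d j - \sum_d Gam d c j * T k d.

Definition hess (P : jf) : tensor2 := cov1 (cov0 P).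

(* Riem c d a b = R^c_dab, with [nabla_a, nabla_b] V^c = R^c_dab V^d *)
Definition Riem (c d a b : 'I_3) : jf :=
  Ds a (Gam c b d) - Ds b (Gam c a d)
  + \sum_e (Gam c a e * Gam e b d - Gam c b e * Gam e a d).
Definition Ric : tensor2 := fun d b => \sum_c Riem c d c b.
Definition Riemd (k i j m : 'I_3) : jf := \sum_c gd k c * Riem c i j m.

(* Km k j = K^k_j *)
Definition Km : tensor2 := fun k j => \sum_l gu k l * Kd l j.
Definition Ku : tensor2 := fun k m => \sum_l Km k l * gu l m.
Definition H : jf := \sum_k Km k k.
Definition Nu : tensor1 := fun k => \sum_l gu k l * cov0 N l.

Variable beta : 'rV[R]_4 -> 'rV[R]_3.

Definition bet : tensor1 := fun k z => beta z.1 0 k.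
Definition Lie0 (P : jf) : jf := \sum_k bet k * Ds k P.
Definition Lie2 (T : tensor2) : tensor2 := fun i j =>
  \sum_k (bet k * Ds k (T i j) + Ds i (bet k) * T k j + Ds j (bet k) * T i k).

(* The total time derivative in which hat-d_0 g_ij is replaced by -2 N K_ij:
   d_t g_ij, and its derivatives, are replaced by Lie_beta g_ij - 2 N K_ij and
   its derivatives, while K and N are differentiated as usual. The reduced
   expressions below only contain purely spatial derivatives of g. *)
Definition gdot : tensor2 := fun i j => Lie2 gd i j - 2%:R *: (N * Kd i j).
Definition Dt (P : jf) : jf :=
  jderive ord0
    (fun u a => match u with
                | inl (inl p) => Dmulti a (gdot (val p).1 (val p).2)
                | _ => jvar u (mincr ord0 a)
                end) P.

Definition hat0 (P : jf) : jf := Dt P - Lie0 P.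
Definition hat2 (T : tensor2) : tensor2 := fun i j => Dt (T i j) - Lie2 T i j.

Definition Box0 (P : jf) : jf :=
  - (Ninv * hat0 (Ninv * hat0 P)) + \sum_k \sum_l gu k l * cov1 (cov0 P) k l.
Definition Box2 (T : tensor2) : tensor2 := fun i j =>
  - (Ninv * hat2 (fun i' j' => Ninv * hat2 T i' j') i j)
  + \sum_k \sum_l gu k l * cov3 (cov2 T) k l i j.

Definition Jt : tensor2 := fun i j =>
  hat2 (fun i' j' => H * Kd i' j'
                     - 2%:R *: \sum_k Km k i' * Kd j' k) i j
  + (Ninv ^+ 2 * hat0 N + H) * hess N i j
  - 2%:R *: (Ninv * \sum_k cov0 N k *
       sym (fun i' j' => cov11 (fun k' l' => N * Km k' l') i' k j') i j)
  + 3%:R *: \sum_k Nu k * cov2 Kd k i j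
  + Ninv * Kd i j *
      (\sum_k \sum_l gu k l * cov1 (fun m => N * cov0 N m) k l)
  - 2%:R *: sym (cov1 (fun j' => \sum_k Km k j' * cov0 N k)) i j
  + Ninv * H * hess (N ^+ 2) i j
  + 2%:R *: (Ninv * sym (fun i' j' => cov0 H i' * cov0 (N ^+ 2) j') i j)
  - 2%:R *: (N * sym (fun i' j' => \sum_k Km k i' * Ric j' k) i j)
  - 2%:R *: (N * \sum_k \sum_m Riemd k i j m * Ku k m).

Definition Ct : tensor2 := fun i j =>
  hess (hat0 (Ninv * hat0 N) + N * hat0 H) i j
  - hat2 (fun i' j' => Ninv * hess (hat0 N + N ^+ 2 * H) i' j') i j.

Variable F : @source_arg R -> R.

Definition Fj : jf := fun z =>
  F (z.1, N z, gmx z, Kmx z, \row_mu Dtot mu N z).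

Definition fK : tensor2 := fun i j =>
  - (Ninv * (hat0 N * Box2 Kd i j + hat2 Jt i j
     + hess (N * Fj - N ^+ 2 * \sum_m \sum_k Ku m k * Kd m k) i j
     + Ct i j)).

(* The equations, all terms on the left-hand side. In the first equation the
   time derivative is the true one; in the others it is the reduced one. *)
Definition eq_g : tensor2 := fun i j =>
  Dtot ord0 (gd i j) - Lie2 gd i j + 2%:R *: (N * Kd i j).
Definition eq_K : tensor2 := fun i j => hat2 (Box2 Kd) i j - fK i j.
Definition eq_N : jf := hat0 (Box0 N) - hat0 Fj.

Definition reduced_system (e : unknown) : jf :=
  match e with
  | inl (inl p) => eq_g (val p).1 (val p).2
  | inl (inr p) => eq_K (val p).1 (val p).2
  | inr _ => eq_N
  end.

End System.

(* Jets, over the chart c, with N > 0 and g properly Riemannian. *)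
Definition admissible (R : realType) (M : manifold3 R) (c : chart M) :
    set (jet R unknown) :=
  [set z | [/\ spatial_image c (spat z.1), 0 < N z & posdef (gmx z)]].

Definition fK_orders (u : unknown) : nat :=
  match u with inr _ => 3%N | _ => 2%N end.

(* Main.v *)
(* The Leray-Volevich indices are m = (3, 3, 4) for the unknowns (g, K, N) and
   n = (2, 0, 1) for the corresponding equations, so each equation need only be
   known modulo expressions whose orders in (g, K, N) are at most (0, 0, 1),
   (2, 2, 3) and (1, 1, 2) respectively.

   Orders are counted on a class of smooth jet functions that is stable under
   total derivatives. There hat-d_0, with d_t g replaced by L_beta g - 2 N K,
   raises the orders in K and N by one but not the order in g, and its
   commutator with a spatial derivative is of lower order. Order counting then
   bounds every term of f_ij except C_ij, whose two halves have the same
   principal part N^-1 hat-d_0 d_i d_j hat-d_0 N + N hat-d_0 d_i d_j H.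

   With L = xi_0 - beta^k xi_k, the diagonal symbols are L for g and
   L (- N^-2 L^2 + g^kl xi_k xi_l) for K and N. All are strictly hyperbolic with
   respect to the cone L > 0, N^-2 L^2 > g^kl xi_k xi_l: translating xi along tau
   to make L vanish makes the quadratic factor positive at the root of L, whereas
   its leading coefficient is negative, so its two roots are simple and differ
   from that of L. *)
Require Import Defs.
From mathcomp Require Import all_boot all_order all_algebra.
From mathcomp Require Import all_classical all_reals all_analysis.
From mathcomp Require Import perm ring lra.
Set Implicit Arguments.
Unset Strict Implicit.
Unset Printing Implicit Defensive.
Import Order.TTheory GRing.Theory Num.Theory.
Import numFieldNormedType.Exports.
Local Open Scope classical_set_scope.
Local Open Scope ring_scope.

(** * Smooth jet functions and their orders *)

(** Jet space is infinite-dimensional, and the equations make sense only where N > 0 and g is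
    invertible. Instead of a notion of smoothness on it, an inductively generated class is used: jet
    variables, coordinates and constants, closed under sums, products, inverses and smooth functions
    of finitely many members. Its index bounds the orders, and every fact about it is an induction
    on the generation. In particular a derivation, or a commutator of two, is controlled by its
    values on coordinates and jet variables.

    The orders in g, K and N have to be counted separately. The operator hat-d_0 turns a derivative
    of g into derivatives of g, K and N of the same order, so its order estimate carries the
    condition that the bound on g exceeds those on K and N by at most one. For this reason
    intermediate bounds are often sharper than the ones finally wanted.

    Each half of C_ij has order 3 in K and 4 in N, one too many for the indices. The cancellation is
    proved with congruences modulo the class, which, unlike agreement of principal symbols, can be
    differentiated. *)

Definition jline (R : realType) (U : finType) (z : jet R U) (w : 'rV[R]_4)
    (y : U -> midx -> R) (s : R) : jet R U :=
  (z.1 + s *: w, fun u a => z.2 u a + s * y u a).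

(** Openness along straight lines is what a directional derivative needs, and it avoids a topology
    on jet space. *)
Definition line_open (R : realType) (U : finType) (A : set (jet R U)) :=
  forall z w y, A z -> \forall s \near (0 : R), A (jline z w y s).

Definition iter_derive (R : realType) (V : normedModType R) (l : seq V)
    (G : V -> R) : V -> R := foldr (fun v h => 'D_v h) G l.

Section SmoothJets.
Variables (R : realType) (U : finType) (A : set (jet R U)).
Implicit Types (P Q : jfun R U) (r : U -> nat).

Lemma jaddE P Q z : (P + Q) z = P z + Q z. Proof. by []. Qed.
Lemma joppE P z : (- P) z = - P z. Proof. by []. Qed.
Lemma jmulE P Q z : (P * Q) z = P z * Q z. Proof. by []. Qed.
Lemma jscaleE k P z : (k *: P) z = k * P z. Proof. by []. Qed.
Lemma jsumE (I : Type) (l : seq I) (p : pred I) (F : I -> jfun R U) z :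
  (\sum_(i <- l | p i) F i) z = \sum_(i <- l | p i) F i z.
Proof. by elim/big_rec2: _ => // i y1 y2 _ <-. Qed.
Definition jE := (jaddE, joppE, jmulE, jscaleE, jsumE).

(** Presents a vector-valued argument by finitely many scalar jet functions, so that the source F
    and the shift can enter the class by composition. *)
Definition lincomb (V : lmodType R) (I : finType) (e : I -> V) (p : I -> jfun R U)
    (z : jet R U) : V := \sum_i p i z *: e i.

(* The derivatives of G in [jsmooth_comp] need not exist off the domain of G, so
   smoothness is only required at the values taken on A. *)
Inductive jsmooth r : jfun R U -> Prop :=
| jsmooth_jvar u a : (mdeg a <= r u)%N -> jsmooth r (jvar u a)
| jsmooth_coord c : jsmooth r (fun z => z.1 0 c)
| jsmooth_cst k : jsmooth r (fun=> k)
| jsmoothD P Q : jsmooth r P -> jsmooth r Q -> jsmooth r (P + Q)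
| jsmoothM P Q : jsmooth r P -> jsmooth r Q -> jsmooth r (P * Q)
| jsmoothV P : jsmooth r P -> (forall z, A z -> P z != 0) ->
    jsmooth r (fun z => (P z)^-1)
| jsmooth_comp (V : normedModType R) (I : finType) (e : I -> V) (p : I -> jfun R U)
    (G : V -> R) : (forall i, jsmooth r (p i)) ->
    (forall l z, A z -> differentiable (iter_derive l G) (lincomb e p z)) ->
    jsmooth r (fun z => G (lincomb e p z))
| jsmooth_ext P Q : jsmooth r P -> (forall z, A z -> P z = Q z) ->
    jsmooth r Q.

Lemma jsmoothW r r' P : (forall u, (r u <= r' u)%N) -> jsmooth r P ->
  jsmooth r' P.
Proof.
move=> le_r; elim=> {P}.
- by move=> u a /leq_trans; move=> /(_ _ (le_r u)); exact: jsmooth_jvar.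
- exact: jsmooth_coord.
- exact: jsmooth_cst.
- by move=> P Q _ + _; exact: jsmoothD.
- by move=> P Q _ + _; exact: jsmoothM.
- by move=> P _; exact: jsmoothV.
- by move=> V I e p G _ hp hG; exact: jsmooth_comp.
- by move=> P Q _ hP; exact: jsmooth_ext.
Qed.

(** The passage from the class to [order_at_most] and [lower_order], which speak only of dependence
    on jet variables. *)
Lemma jsmooth_depend r P z z' : jsmooth r P -> A z -> A z' -> z.1 = z'.1 ->
  (forall u a, (mdeg a <= r u)%N -> z.2 u a = z'.2 u a) -> P z = P z'.
Proof.
move=> hP Az Az' e1 e2; elim: hP => {P} //=.
- by move=> c; rewrite e1.
- by move=> P Q _ hP _ hQ; rewrite /= [LHS]/(P z + Q z) hP hQ.
- by move=> P Q _ hP _ hQ; rewrite /= [LHS]/(P z * Q z) hP hQ.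
- by move=> P _ ->.
- move=> V I e p G _ hp _; congr (G _); apply: eq_bigr => i _.
  by rewrite hp.
- by move=> P Q _ hP PQ; rewrite -!PQ.
Qed.

Lemma jsmoothN r P : jsmooth r P -> jsmooth r (- P).
Proof.
move=> hP; apply: (jsmooth_ext (jsmoothM (jsmooth_cst r (-1)) hP)) => z _ /=.
by rewrite [LHS]mulN1r.
Qed.

Lemma jsmoothB r P Q : jsmooth r P -> jsmooth r Q -> jsmooth r (P - Q).
Proof. by move=> hP hQ; apply: jsmoothD => //; exact: jsmoothN. Qed.

Lemma jsmoothZ r k P : jsmooth r P -> jsmooth r (k *: P).
Proof. by move=> hP; apply: (jsmooth_ext (jsmoothM (jsmooth_cst r k) hP)). Qed.

Lemma jsmooth0 r : jsmooth r 0.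
Proof. exact: jsmooth_cst. Qed.

Lemma jsmooth1 r : jsmooth r 1.
Proof. exact: jsmooth_cst. Qed.

Lemma jsmooth_sum r (I : Type) (s : seq I) (p : pred I) (F : I -> jfun R U) :
  (forall i, p i -> jsmooth r (F i)) -> jsmooth r (\sum_(i <- s | p i) F i).
Proof.
by move=> hF; elim/big_ind: _ => //; [exact: jsmooth0 | exact: jsmoothD].
Qed.

Lemma jsmooth_prod r (I : Type) (s : seq I) (p : pred I) (F : I -> jfun R U) :
  (forall i, p i -> jsmooth r (F i)) -> jsmooth r (\prod_(i <- s | p i) F i).
Proof.
by move=> hF; elim/big_ind: _ => //; [exact: jsmooth1 | exact: jsmoothM].
Qed.

Lemma jsmoothX r n P : jsmooth r P -> jsmooth r (P ^+ n).
Proof.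
move=> hP; elim: n => [|n IH]; first exact: jsmooth1.
by rewrite exprS; exact: jsmoothM.
Qed.

Definition smooth P := exists r, jsmooth r P.

Lemma smooth_both P Q : smooth P -> smooth Q ->
  exists r, jsmooth r P /\ jsmooth r Q.
Proof.
move=> [r hP] [s hQ]; exists (fun u => maxn (r u) (s u)).
by split; [move: hP|move: hQ]; apply: jsmoothW => u; rewrite ?leq_maxl ?leq_maxr.
Qed.

Lemma smoothD P Q : smooth P -> smooth Q -> smooth (P + Q).
Proof.
by move=> hP hQ; have [r [? ?]] := smooth_both hP hQ; exists r; exact: jsmoothD.
Qed.

Lemma smoothM P Q : smooth P -> smooth Q -> smooth (P * Q).
Proof.
by move=> hP hQ; have [r [? ?]] := smooth_both hP hQ; exists r; exact: jsmoothM.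
Qed.

(** The rules are restricted to smooth functions and to points of A, since elsewhere a derivative
    may be a default value. The interface is closed under sums and under multiplication by
    functions, and so covers [hat0], which is not of the form [jderive]. *)
Record derivation (D : jfun R U -> jfun R U) : Prop := Derivation {
  der_ext : forall P Q, (forall z, A z -> P z = Q z) ->
    forall z, A z -> D P z = D Q z;
  der_cst : forall k z, A z -> D (fun=> k) z = 0;
  derD : forall P Q, smooth P -> smooth Q ->
    forall z, A z -> D (P + Q) z = D P z + D Q z;
  derM : forall P Q, smooth P -> smooth Q ->
    forall z, A z -> D (P * Q) z = D P z * Q z + P z * D Q z;
  derV : forall P, smooth P -> (forall z, A z -> P z != 0) ->
    forall z, A z -> D (fun z => (P z)^-1) z = - (P z) ^- 2 * D P z;
  der_comp : forall (V : normedModType R) (I : finType) (e : I -> V)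
      (p : I -> jfun R U) (G : V -> R), (forall i, smooth (p i)) ->
    forall z, A z -> differentiable G (lincomb e p z) ->
    D (fun z => G (lincomb e p z)) z
    = \sum_i D (p i) z * 'D_(e i) G (lincomb e p z) }.

Section Jderive.
Hypothesis Aopen : line_open A.

Lemma jline0 (z : jet R U) w y : jline z w y 0 = z.
Proof.
case: z => x j; rewrite /jline /= scale0r addr0; congr pair.
by apply/funext => u; apply/funext => a; rewrite mul0r addr0.
Qed.

Lemma is_derive_scale (V : normedModType R) (f : R -> R) (df : R) (v : V) :
  is_derive (0 : R) (1 : R) f df ->
  is_derive (0 : R) (1 : R) (fun s => f s *: v) (df *: v).
Proof.
move=> [dfi <-]; have dff := (iffLR (derivable1_diffP _ _) dfi).
have dZ : differentiable (fun s : R => f s *: v) 0 by exact: differentiableZl.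
apply: DeriveDef; first exact: diff_derivable.
by rewrite deriveE // diffZl //= deriveE.
Qed.

Lemma is_derive_lincomb (V : normedModType R) (I : finType) (e : I -> V)
    (p : I -> R -> R) (dp : I -> R) :
  (forall i, is_derive (0 : R) (1 : R) (p i) (dp i)) ->
  is_derive (0 : R) (1 : R) (fun s => \sum_i p i s *: e i) (\sum_i dp i *: e i).
Proof.
move=> hp; elim: (index_enum I) => [|i l IH].
  by rewrite big_nil; under eq_fun do rewrite big_nil; exact: is_derive_cst.
rewrite big_cons; under eq_fun do rewrite big_cons.
exact: (is_deriveD (is_derive_scale (e i) (hp i)) IH).
Qed.

Lemma is_derive_comp (V : normedModType R) (f : R -> V) (G : V -> R) df :
  is_derive (0 : R) (1 : R) f df -> differentiable G (f 0) ->
  is_derive (0 : R) (1 : R) (G \o f) ('D_df G (f 0)).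
Proof.
move=> [dfi <-] dG; have dff := (iffLR (derivable1_diffP _ _) dfi).
have dGf : differentiable (G \o f) 0 by exact: differentiable_comp.
apply: DeriveDef; first exact: diff_derivable.
by rewrite deriveE // diff_comp //= !deriveE.
Qed.

Lemma derive_sumZ (V : normedModType R) (I : finType) (e : I -> V) (k : I -> R)
    (G : V -> R) x : differentiable G x ->
  'D_(\sum_i k i *: e i) G x = \sum_i k i * 'D_(e i) G x.
Proof.
move=> dG; rewrite deriveE // linear_sum; apply: eq_bigr => i _.
by rewrite linearZ deriveE.
Qed.

Lemma jsmooth_derivable r P : jsmooth r P -> forall z w y, A z ->
  derivable (fun s => P (jline z w y s)) (0 : R) (1 : R).
Proof.
elim=> {P} [u a _|c|k|P Q _ hP _ hQ|P Q _ hP _ hQ|P _ hP P0|V I e p G _ hp hG|P Q _ hP PQ] z w y Az.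
- rewrite /jvar /jline /=.
  apply: derivableD; first exact: derivable_cst.
  by apply: derivableM; [exact: derivable_id|exact: derivable_cst].
- rewrite /jline /=; under eq_fun do rewrite !mxE.
  apply: derivableD; first exact: derivable_cst.
  by apply: derivableM; [exact: derivable_id|exact: derivable_cst].
- exact: derivable_cst.
- by apply: (derivableD (hP _ _ _ _) (hQ _ _ _ _)).
- by apply: (derivableM (hP _ _ _ _) (hQ _ _ _ _)).
- by apply: derivableV; [rewrite jline0; exact: P0|exact: hP].
- have hd i := derivableP (hp i z w y Az).
  have hl := is_derive_lincomb e hd.
  have := @is_derive_comp _ _ G _ hl.
  (* The empty list of directions gives differentiability of G itself. *)
  rewrite /= -/(lincomb e p (jline z w y 0)) jline0 => /(_ (hG [::] z Az)).
  by case.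
- apply: near_eq_derivable (hP z w y Az).
  by near=> s; apply: PQ; near: s; exact: Aopen.
Unshelve. all: by end_near. Qed.

(** At a given jet the vector field is frozen at its value there, so each rule is a one-variable
    rule along a straight line. *)
Lemma jderive_derivation c v : derivation (jderive c v).
Proof.
have drv P z w y : smooth P -> A z ->
    derivable (fun s => P (jline z w y s)) (0 : R) (1 : R).
  by move=> [r hr]; exact: jsmooth_derivable hr z w y.
pose Y z : U -> midx -> R := fun u a => v u a z.
have E P z : jderive c v P z = 'D_1 (fun s => P (jline z (delta_mx 0 c) (Y z) s)) (0 : R).
  by rewrite /jderive derive1E.
split.
- move=> P Q PQ z Az; rewrite !E; apply: near_eq_derive.
  by near=> s; apply: PQ; near: s; exact: Aopen.
- by move=> k z Az; rewrite E derive_cst.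
- move=> P Q hP hQ z Az; rewrite !E.
  exact: (deriveD (drv _ _ _ _ hP Az) (drv _ _ _ _ hQ Az)).
- move=> P Q hP hQ z Az; rewrite !E.
  rewrite [LHS](deriveM (drv _ _ _ _ hP Az) (drv _ _ _ _ hQ Az)) !jline0.
  by rewrite addrC /GRing.scale /= mulrC.
- move=> P hP P0 z Az; rewrite !E.
  rewrite (deriveV _ (drv _ _ _ _ hP Az)) !jline0 //.
  by apply: P0.
- move=> V I e p G hp z Az dG; rewrite E.
  have hd i := derivableP (drv _ z (delta_mx 0 c) (Y z) (hp i) Az).
  have hl := is_derive_lincomb e hd.
  have := @is_derive_comp _ _ G _ hl.
  rewrite /= -/(lincomb e p (jline z _ _ 0)) jline0 => /(_ dG) [_ ->].
  by rewrite derive_sumZ //; apply: eq_bigr => i _; rewrite E.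
Unshelve. all: by end_near. Qed.

End Jderive.
End SmoothJets.

(** * Algebra of derivations, their effect on orders, and commutators *)

Section Derivations.
Variables (R : realType) (U : finType) (A : set (jet R U)).
Implicit Types (P Q : jfun R U) (D : jfun R U -> jfun R U) (r s : U -> nat).

Lemma derivation_eq D D' : (forall P z, D' P z = D P z) ->
  derivation A D -> derivation A D'.
Proof.
move=> E hD; split=> *; rewrite !E.
- exact: (der_ext hD).
- exact: (der_cst hD).
- exact: (derD hD).
- exact: (derM hD).
- exact: (derV hD).
- by under eq_bigr do rewrite E; exact: (der_comp hD).
Qed.

Lemma derivation_add D D' : derivation A D -> derivation A D' ->
  derivation A (fun P => D P + D' P).
Proof.
move=> h h'; split=> [P Q PQ z Az|k z Az|P Q hP hQ z Az|P Q hP hQ z Az|P hP P0 z Az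
  |V I e p G hp z Az dG].
- by rewrite !jE (der_ext h PQ) // (der_ext h' PQ).
- by rewrite jE (der_cst h) // (der_cst h') // addr0.
- by rewrite !jE (derD h) // (derD h') //; ring.
- by rewrite !jE (derM h) // (derM h') //; ring.
- by rewrite !jE (derV h) // (derV h') // -mulrDr.
- rewrite jE (der_comp h) // (der_comp h') // -big_split /=.
  by apply: eq_bigr => i _; rewrite jE -mulrDl.
Qed.

Lemma derivation_mul D q : derivation A D -> derivation A (fun P => q * D P).
Proof.
move=> h; split=> [P Q PQ z Az|k z Az|P Q hP hQ z Az|P Q hP hQ z Az|P hP P0 z Az
  |V I e p G hp z Az dG].
- by rewrite !jE (der_ext h PQ).
- by rewrite jE (der_cst h) // mulr0.
- by rewrite !jE (derD h) // mulrDr.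
- by rewrite !jE (derM h) //; ring.
- by rewrite !jE (derV h) // mulrCA.
- rewrite jE (der_comp h) // mulr_sumr /=.
  by apply: eq_bigr => i _; rewrite jE mulrA.
Qed.

Lemma derivation0 : derivation A (fun=> 0).
Proof.
split=> //.
- by move=> *; rewrite addr0.
- by move=> *; rewrite mulr0 mul0r addr0.
- by move=> *; rewrite mulr0.
- by move=> *; rewrite big1 // => i _; rewrite mul0r.
Qed.

Lemma derivation_sum (I : Type) (l : seq I) (D : I -> jfun R U -> jfun R U) :
  (forall i, derivation A (D i)) -> derivation A (fun P => \sum_(i <- l) D i P).
Proof.
move=> hD; elim: l => [|i l IH].
  by apply: derivation_eq derivation0 => P z; rewrite big_nil.
by apply: derivation_eq (derivation_add (hD i) IH) => P z; rewrite big_cons.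
Qed.

Section OneDerivation.
Variable D : jfun R U -> jfun R U.
Hypothesis hD : derivation A D.

Lemma derN P z : smooth A P -> A z -> D (- P) z = - D P z.
Proof.
move=> hP Az; rewrite (der_ext hD (Q := (fun=> -1) * P)) //; last first.
  by move=> z' _; rewrite [RHS]mulN1r.
rewrite (derM hD) //; last by exists (fun=> 0%N); exact: jsmooth_cst.
by rewrite (der_cst hD) // mul0r add0r mulN1r.
Qed.

Lemma smoothN P : smooth A P -> smooth A (- P).
Proof. by move=> [r hr]; exists r; exact: jsmoothN. Qed.

Lemma derB P Q z : smooth A P -> smooth A Q -> A z ->
  D (P - Q) z = D P z - D Q z.
Proof. by move=> hP hQ Az; rewrite (derD hD) // ?derN //; exact: smoothN. Qed.

Lemma smooth_sum (I : eqType) (l : seq I) (F : I -> jfun R U) :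
  (forall i, smooth A (F i)) -> smooth A (\sum_(i <- l) F i).
Proof.
move=> hF; elim/big_ind: _ => //; last exact: smoothD.
by exists (fun=> 0%N); exact: jsmooth_cst.
Qed.

Lemma der_sum (I : eqType) (l : seq I) (F : I -> jfun R U) z :
  (forall i, smooth A (F i)) -> A z ->
  D (\sum_(i <- l) F i) z = \sum_(i <- l) D (F i) z.
Proof.
move=> hF Az; elim: l => [|i l IH].
  by rewrite !big_nil; exact: (der_cst hD).
by rewrite !big_cons (derD hD) ?IH //; exact: smooth_sum.
Qed.

(** A direction appended at the end of the list is the first to act on G, so the smoothness
    hypothesis passes from G to its derivative. *)
Lemma jsmooth_derive_comp r (V : normedModType R) (I : finType) (e : I -> V)
    (p : I -> jfun R U) (G : V -> R) v : (forall i, jsmooth A r (p i)) ->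
  (forall l z, A z -> differentiable (iter_derive l G) (lincomb e p z)) ->
  jsmooth A r (fun z => 'D_v G (lincomb e p z)).
Proof.
move=> hp hG; apply: (jsmooth_comp (G := 'D_v G)) => // l z Az.
by have := hG (rcons l v) z Az; rewrite /iter_derive foldr_rcons.
Qed.

(** A derivation is determined on the class by its values on coordinates and jet variables. The
    bound r <= s accounts for the undifferentiated factors that the product rule leaves. *)
Lemma jsmooth_derivation r s : (forall u, (r u <= s u)%N) ->
  (forall c, jsmooth A s (D (fun z => z.1 0 c))) ->
  (forall u a, (mdeg a <= r u)%N -> jsmooth A s (D (jvar u a))) ->
  forall P, jsmooth A r P -> jsmooth A s (D P).
Proof.
move=> rs hc hj P; elim=> {P} [u a /hj //|c|k|P Q hP DP hQ DQ|P Q hP DP hQ DQ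
  |P hP DP P0|V I e p G hp Dp hG|P Q hP DP PQ].
- exact: hc.
- by apply: (jsmooth_ext (jsmooth_cst A s 0)) => z Az; rewrite (der_cst hD).
- apply: (jsmooth_ext (jsmoothD DP DQ)) => z Az.
  by rewrite (derD hD) //; exists r.
- have hP' := jsmoothW rs hP; have hQ' := jsmoothW rs hQ.
  apply: (jsmooth_ext (jsmoothD (jsmoothM DP hQ') (jsmoothM hP' DQ))) => z Az.
  by rewrite (derM hD) //; exists r.
- have hV := jsmoothV (jsmoothW rs hP) P0.
  apply: (jsmooth_ext (jsmoothM (jsmoothN (jsmoothM hV hV)) DP)) => z Az.
  by rewrite (derV hD) //; [rewrite expr2 invfM | exists r].
- have hp' i := jsmoothW rs (hp i).
  apply: (@jsmooth_ext _ _ _ _ (\sum_i D (p i) * (fun z => 'D_(e i) G (lincomb e p z)))).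
    apply: jsmooth_sum => i _; apply: jsmoothM; first exact: Dp.
    exact: jsmooth_derive_comp.
  move=> z Az; rewrite (der_comp hD) //; first by rewrite jsumE.
    by move=> i; exists r.
  exact: (hG [::]).
- by apply: (jsmooth_ext DP) => z Az; exact: (der_ext hD).
Qed.

End OneDerivation.

Section Commutator.
Variables (D1 D2 : jfun R U -> jfun R U).
Hypothesis (h1 : derivation A D1) (h2 : derivation A D2).

(* The second derivatives of G in [jsmooth_comp] are not known to be symmetric;
   they only multiply first derivatives, which are already in the class. *)
Lemma jsmooth_commutator r s : (forall u, (r u <= s u)%N) ->
  (forall P, jsmooth A r P -> jsmooth A s (D1 P)) ->
  (forall P, jsmooth A r P -> jsmooth A s (D2 P)) ->
  (forall c, jsmooth A s (D1 (D2 (fun z => z.1 0 c)) - D2 (D1 (fun z => z.1 0 c)))) ->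
  (forall u a, (mdeg a <= r u)%N ->
     jsmooth A s (D1 (D2 (jvar u a)) - D2 (D1 (jvar u a)))) ->
  forall P, jsmooth A r P -> jsmooth A s (D1 (D2 P) - D2 (D1 P)).
Proof.
move=> rs hr1 hr2 hc hj P.
have sm1 Q : jsmooth A r Q -> smooth A (D1 Q) by exists s; exact: hr1.
have sm2 Q : jsmooth A r Q -> smooth A (D2 Q) by exists s; exact: hr2.
have sm Q : jsmooth A r Q -> smooth A Q by exists r.
elim=> {P} [u a /hj //|c|k|P Q hP DP hQ DQ|P Q hP DP hQ DQ
  |P hP DP P0|V I e p G hp Dp hG|P Q hP DP PQ].
- exact: hc.
- apply: (jsmooth_ext (jsmooth_cst A s 0)) => z Az; rewrite 2![in RHS]jE.
  rewrite (der_ext h1 (Q := fun=> 0)) //; last by move=> *; rewrite (der_cst h2).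
  rewrite (der_ext h2 (Q := fun=> 0)) //; last by move=> *; rewrite (der_cst h1).
  by rewrite !(der_cst h1, der_cst h2) // subr0.
- apply: (jsmooth_ext (jsmoothD DP DQ)) => z Az.
  rewrite 2![in RHS]jE (der_ext h1 (Q := D2 P + D2 Q)) //; last first.
    by move=> *; rewrite (derD h2) //; exact: sm.
  rewrite (der_ext h2 (Q := D1 P + D1 Q)) //; last first.
    by move=> *; rewrite (derD h1) //; exact: sm.
  rewrite (derD h1) ?(derD h2); auto.
  by rewrite !jE; ring.
- have hP' := jsmoothW rs hP; have hQ' := jsmoothW rs hQ.
  apply: (jsmooth_ext (jsmoothD (jsmoothM DP hQ') (jsmoothM hP' DQ))) => z Az.
  rewrite 2![in RHS]jE (der_ext h1 (Q := D2 P * Q + P * D2 Q)) //; last first.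
    by move=> *; rewrite (derM h2) //; exact: sm.
  rewrite (der_ext h2 (Q := D1 P * Q + P * D1 Q)) //; last first.
    by move=> *; rewrite (derM h1) //; exact: sm.
  rewrite (derD h1) ?(derD h2); auto using smoothM.
  rewrite !(derM h1) ?(derM h2); auto.
  by rewrite !jE; ring.
- have hV := jsmoothV hP P0; have hV' := jsmoothW rs hV.
  have hM := jsmoothN (jsmoothM hV hV); have hM' := jsmoothW rs hM.
  set V := (fun z => _) in hV.
  have sV : smooth A V by exists r.
  have sVV : smooth A (- (V * V)) by exists r.
  (* The terms in which [- (V * V)] is differentiated are symmetric in [D1] and [D2] and cancel. *)
  apply: (jsmooth_ext (jsmoothM hM' DP)) => z Az.
  rewrite 2![in RHS]jE.
  rewrite (der_ext h1 (Q := - (V * V) * D2 P)) //; last first.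
    by move=> *; rewrite (derV h2) //; [rewrite expr2 invfM| exact: sm].
  rewrite (der_ext h2 (Q := - (V * V) * D1 P)) //; last first.
    by move=> *; rewrite (derV h1) //; [rewrite expr2 invfM| exact: sm].
  rewrite (derM h1) ?(derM h2); auto.
  rewrite (derN h1) ?(derN h2) ?(derM h1) ?(derM h2); auto using smoothM.
  rewrite !(derV h1) ?(derV h2); auto.
  by rewrite !jE /V; ring.
- have sp i : smooth A (p i) by exists r.
  have hp' i := jsmoothW rs (hp i).
  pose G1 i := (fun z => 'D_(e i) G (lincomb e p z)).
  have hG1 i : jsmooth A r (G1 i) by exact: jsmooth_derive_comp.
  pose G2 i j := (fun z => 'D_(e j) ('D_(e i) G) (lincomb e p z)).
  have dG i z : A z -> differentiable ('D_(e i) G) (lincomb e p z).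
    exact: (hG [:: e i]).
  have hG2 i j : jsmooth A r (G2 i j).
    apply: (@jsmooth_derive_comp _ _ _ _ _ ('D_(e i) G)) => // l z Az.
    by have := hG (rcons l (e i)) z Az; rewrite /iter_derive foldr_rcons.
  apply: (@jsmooth_ext _ _ _ _ (\sum_i ((D1 (D2 (p i)) - D2 (D1 (p i))) * G1 i
     + (D2 (p i) * (\sum_j D1 (p j) * G2 i j) - D1 (p i) * \sum_j D2 (p j) * G2 i j)))).
    apply: jsmooth_sum => i _; apply: jsmoothD; [|apply: jsmoothB].
    - by apply: jsmoothM; [exact: Dp|exact: jsmoothW (hG1 i)].
    - apply: jsmoothM; [exact: hr2|apply: jsmooth_sum => j _].
      by apply: jsmoothM; [exact: hr1|exact: jsmoothW (hG2 _ _)].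
    - apply: jsmoothM; [exact: hr1|apply: jsmooth_sum => j _].
      by apply: jsmoothM; [exact: hr2|exact: jsmoothW (hG2 _ _)].
  move=> z Az; rewrite 2![in RHS]jE.
  have E D : derivation A D -> forall z', A z' ->
      D (fun z => G (lincomb e p z)) z' = (\sum_i D (p i) * G1 i) z'.
    move=> hD z' Az'; rewrite (der_comp hD) //; first by rewrite jsumE.
    exact: (hG [::]).
  rewrite (der_ext h1 (E _ h2)) // (der_ext h2 (E _ h1)) //.
  have sG1 i : smooth A (G1 i) by exists r.
  rewrite (der_sum h1) ?(der_sum h2); auto using smoothM.
  rewrite jsumE -sumrB; apply: eq_bigr => i _.
  rewrite (derM h1) ?(derM h2); auto.
  have EG D : derivation A D -> D (G1 i) z = \sum_j D (p j) z * G2 i j z.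
    by move=> hD; apply: (der_comp hD (G := 'D_(e i) G)) => //; exact: dG.
  rewrite (EG _ h1) (EG _ h2).
  rewrite !jE /G2.
  set a := \sum_j _; set b := \sum_j _.
  ring.
- apply: (jsmooth_ext DP) => z Az; congr (_ - _).
    by apply: (der_ext h1) => // z' Az'; exact: (der_ext h2).
  by apply: (der_ext h2) => // z' Az'; exact: (der_ext h1).
Qed.

End Commutator.
End Derivations.

(** * Positive definite metrics *)

Section PosDef.
Variable R : realType.
Implicit Types (g h : 'M[R]_3) (v : 'rV[R]_3).

Lemma continuous_fun_sum (T : topologicalType) (I : Type) (l : seq I)
    (F : I -> T -> R) : (forall i, continuous (F i)) ->
  continuous (fun x => \sum_(i <- l) F i x).
Proof.
move=> hF x; elim: l => [|i l IH].
  by under eq_fun do rewrite big_nil; exact: cst_continuous.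
under eq_fun do rewrite big_cons.
by apply: continuousD; [exact: hF|exact: IH].
Qed.

Lemma continuous_fun_mul (T : topologicalType) (f h : T -> R) :
  continuous f -> continuous h -> continuous (fun x => f x * h x).
Proof. by move=> hf hh x; exact: (continuousM (hf x) (hh x)). Qed.

Definition quadf g v : R := \sum_i \sum_j g i j * (v 0 i * v 0 j).

Lemma quadfE g v : (v *m g *m v^T) 0 0 = quadf g v.
Proof.
rewrite !mxE /quadf exchange_big /=; apply: eq_bigr => j _.
rewrite !mxE mulr_suml; apply: eq_bigr => i _; ring.
Qed.

Lemma entry_continuous n i : continuous (fun v : 'rV[R]_n => v 0 i).
Proof. by move=> x; exact: (@coord_continuous R 1 n 0 i). Qed.

Lemma quadf_continuous g : continuous (quadf g).
Proof.
apply: continuous_fun_sum => i; apply: continuous_fun_sum => j.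
apply: continuous_fun_mul; first by move=> ?; exact: cst_continuous.
by apply: continuous_fun_mul; exact: entry_continuous.
Qed.

Lemma quadfZ g k v : quadf g (k *: v) = k ^+ 2 * quadf g v.
Proof.
rewrite /quadf mulr_sumr; apply: eq_bigr => i _; rewrite mulr_sumr.
by apply: eq_bigr => j _; rewrite !mxE; ring.
Qed.

Lemma entry_le_norm v i : `|v 0 i| <= `|v|.
Proof.
by rewrite [leRHS]/Num.Def.normr /= mx_normrE; apply/bigmax_geP; right => /=; exists (0, i).
Qed.

(** The constant is the minimum of the form on the compact unit sphere; homogeneity carries the
    bound to all vectors. *)
Lemma posdef_coercive g : posdef g ->
  exists2 e, 0 < e & forall v, e * `|v| ^+ 2 <= quadf g v.
Proof.
move=> gpos; pose S := [set v : 'rV[R]_3 | `|v| = 1].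
have S0 : S !=set0.
  have n0 : `|(const_mx 1 : 'rV[R]_3)| != 0.
    rewrite normr_eq0; apply/negP => /eqP /matrixP /(_ 0 0).
    by rewrite !mxE; apply/eqP; exact: oner_neq0.
  exists (`|(const_mx 1 : 'rV[R]_3)|^-1 *: const_mx 1); rewrite /S /= normrZ.
  by rewrite normfV normr_id mulVf.
have cS : compact S.
  apply: bounded_closed_compact.
    by exists 1; split; [exact: num_real|move=> M M1 v /= ->; exact: ltW].
  rewrite (_ : S = (fun v => `|v|) @^-1` [set x : R | x = 1]) //.
  by apply: preimage_closed; [move=> v _; exact: norm_continuous|exact: closed_eq].
have [c cSi cmin] := EVT_min_rV S0 cS (continuous_subspaceT (@quadf_continuous g)).
have Sc : `|c| = 1 by move: cSi; rewrite inE.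
exists (quadf g c).
  by rewrite -quadfE; apply: gpos; rewrite -normr_eq0 Sc oner_neq0.
move=> v; have [->|v0] := eqVneq v 0.
  rewrite normr0 expr0n /= mulr0.
  by rewrite -(scale0r (0 : 'rV[R]_3)) quadfZ expr0n /= mul0r.
have nv : `|v| != 0 by rewrite normr_eq0.
have -> : v = `|v| *: (`|v|^-1 *: v) by rewrite scalerA mulfV // scale1r.
set u := _^-1 *: v.
have nu : `|u| = 1 by rewrite normrZ normfV normr_id mulVf.
rewrite normrZ nu mulr1 normr_id quadfZ mulrC ler_wpM2l ?exprn_ge0 //.
by apply: cmin; rewrite inE.
Qed.

Lemma quadf_bound h v : quadf h v <= (\sum_i \sum_j `|h i j|) * `|v| ^+ 2.
Proof.
rewrite /quadf mulr_suml; apply: ler_sum => i _; rewrite mulr_suml.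
apply: ler_sum => j _; apply: le_trans (ler_norm _) _.
rewrite normrM ler_wpM2l // normrM expr2.
by apply: ler_pM => //; exact: entry_le_norm.
Qed.

(** The perturbation changes the form at v by less than |s| M |v|^2, which the coercivity constant e
    absorbs once |s| < e / M. *)
Lemma posdef_line_open g h : posdef g ->
  \forall s \near (0 : R), posdef (g + s *: h).
Proof.
move=> /posdef_coercive[e e0 ge].
(* The added 1 keeps M positive when h vanishes. *)
pose M := \sum_i \sum_j `|h i j| + 1.
have M0 : 0 < M.
  by rewrite ltr_wpDl // sumr_ge0 // => i _; rewrite sumr_ge0.
near=> s => v v0; rewrite quadfE.
have -> : quadf (g + s *: h) v = quadf g v - quadf (- s *: h) v.
  rewrite /quadf -sumrB; apply: eq_bigr => i _; rewrite -sumrB.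
  by apply: eq_bigr => j _; rewrite !mxE; ring.
rewrite subr_gt0; apply: le_lt_trans (quadf_bound _ _) _.
apply: lt_le_trans (ge v); rewrite ltr_pM2r; last first.
  by rewrite exprn_gt0 // normr_gt0.
have -> : \sum_i \sum_j `|(- s *: h) i j| = `|s| * (M - 1).
  rewrite /M addrK mulr_sumr; apply: eq_bigr => i _; rewrite mulr_sumr.
  by apply: eq_bigr => j _; rewrite !mxE normrM normrN.
have : `|s| < e / M.
  near: s; apply/nbhs_ballP; exists (e / M) => /=; first exact: divr_gt0.
  by move=> s; rewrite /ball /= sub0r normrN.
rewrite ltr_pdivlMr // => /(le_lt_trans _); apply.
by apply: ler_wpM2l => //; lra.
Unshelve. all: by end_near. Qed.

Lemma posdef_det_neq0 g : posdef g -> \det g != 0.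
Proof.
move=> gpos; apply/det0P => -[v v0 vg]; have := gpos v v0.
by rewrite vg mul0mx mxE ltxx.
Qed.

(** Since g is symmetric, the inverse form at v equals the form g at v g^-1. *)
Lemma posdef_invmx g : g^T = g -> posdef g -> posdef (invmx g).
Proof.
move=> gT gpos v v0; have ug : g \in unitmx by rewrite unitmxE unitfE posdef_det_neq0.
have := gpos (v *m invmx g).
have -> : (v *m invmx g *m g *m (v *m invmx g)^T) = v *m invmx g *m v^T.
  by rewrite mulmxKV // trmx_mul trmx_inv gT mulmxA.
apply; apply: contra_neq v0 => vg.
by rewrite -(mulmxKV ug v) vg mul0mx.
Qed.

Lemma admissible_line_open (M : manifold3 R) (c : chart M) :
  line_open (admissible c).
Proof.
move=> z w y [zI zN zg].
have ct k b : {for (0 : R), continuous (fun s : R => k + s * b : R)}.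
  apply: continuousD; first exact: cst_continuous.
  apply: (continuous_fun_mul (f := id) (h := fun=> b)) => x; last exact: cst_continuous.
  exact: cvg_id.
have c1 : \forall s \near (0 : R), spatial_image c (spat z.1 + s *: spat w).
  have cl : {for (0 : R), continuous (fun s : R => spat z.1 + s *: spat w)}.
    apply: continuousD; first exact: cst_continuous.
    exact: scalel_continuous.
  have nb : nbhs (spat z.1 + 0 *: spat w) (spatial_image c).
    rewrite scale0r addr0; apply: open_nbhs_nbhs; split => //.
    exact: coord_open.
  exact: (cl _ nb).
have c2 : \forall s \near (0 : R), 0 < N z + s * y UN midx0.
  have nb : nbhs (N z + 0 * y UN midx0) [set x | 0 < x].
    by rewrite mul0r addr0; exact: lt_nbhsr.
  exact: (ct (N z) (y UN midx0) _ nb).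
have c3 := posdef_line_open (\matrix_(i, j) y (Ug (sidx i j)) midx0) zg.
near=> s; split.
- have -> : spat (jline z w y s).1 = spat z.1 + s *: spat w.
    by apply/rowP => i; rewrite !mxE.
  by near: s.
- by rewrite /N /jvar /=; near: s.
- have -> : gmx (jline z w y s) = gmx z + s *: \matrix_(i, j) y (Ug (sidx i j)) midx0.
    by apply/matrixP => i j; rewrite !mxE.
  by near: s.
Unshelve. all: by end_near. Qed.

End PosDef.

(** * The reduced time derivative *)

Lemma mdeg_mincr c a : mdeg (mincr c a) = (mdeg a).+1.
Proof.
rewrite /mdeg -[RHS]addn1; under eq_bigr do rewrite ffunE.
rewrite big_split /=; congr addn.
by rewrite (bigD1 c) //= eqxx big1 // => i /negPf; rewrite eq_sym => ->.
Qed.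

Lemma mincrC c d a : mincr c (mincr d a) = mincr d (mincr c a).
Proof. by apply/ffunP => i; rewrite !ffunE addnAC. Qed.

Lemma mdeg0 : mdeg midx0 = 0%N.
Proof. by rewrite /mdeg big1 // => i _; rewrite ffunE. Qed.

Lemma iter_mincr n c a i : iter n (mincr c) a i = (a i + n * (c == i))%N.
Proof.
elim: n => [|n IH]; first by rewrite mul0n addn0.
by rewrite iterS ffunE IH mulSn -addnA [(_ + (c == i))%N]addnC.
Qed.

(** Builds a from zero in the order in which [Dmulti] applies its derivatives, so that one induction
    follows both. *)
Lemma foldr_mincr (a : midx) : foldr (fun c b => iter (a c) (mincr c) b) midx0 (enum 'I_4) = a.
Proof.
apply/ffunP => i.
have E l : foldr (fun c b => iter (a c) (mincr c) b) midx0 l i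
           = (\sum_(c <- l) a c * (c == i))%N.
  elim: l => [|c l IH] /=; first by rewrite big_nil ffunE.
  by rewrite big_cons iter_mincr IH addnC.
rewrite E big_enum /= (bigD1 i) //= eqxx muln1 big1 ?addn0 //.
by move=> j /negPf ->; rewrite muln0.
Qed.

Definition orders (p q s : nat) (u : unknown) : nat :=
  match u with inl (inl _) => p | inl (inr _) => q | inr _ => s end.

Section TimeDerivative.
Variables (R : realType) (M : manifold3 R) (c : chart M).
Variable beta : 'rV[R]_4 -> 'rV[R]_3.
Hypothesis beta_smooth : forall k, smooth_on
  [set x : 'rV[R]_4 | spatial_image c (spat x)] (fun x => beta x 0 k).
Local Notation A := (@admissible R M c).
Local Notation js p q s := (jsmooth A (orders p q s)).
Implicit Types (P Q : jf R) (T : tensor2 R).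

Lemma jsW p q s p' q' s' P : js p q s P -> (p <= p')%N -> (q <= q')%N ->
  (s <= s')%N -> js p' q' s' P.
Proof. by move=> hP *; apply: jsmoothW hP => -[[u|u]|u]. Qed.

Lemma js_smooth p q s P : js p q s P -> smooth A P.
Proof. by exists (orders p q s). Qed.

Lemma lincomb_coord (z : jet R unknown) :
  lincomb (fun i => delta_mx 0 i) (fun i (z : jet R unknown) => z.1 0 i) z = z.1.
Proof. by rewrite /lincomb -row_sum_delta. Qed.

Lemma jsmooth_base r (G : 'rV[R]_4 -> R) :
  (forall l z, A z -> differentiable (iter_derive l G) z.1) ->
  jsmooth A r (fun z => G z.1).
Proof.
move=> hG; rewrite -(_ : (fun z => G (lincomb (fun i => delta_mx 0 i)
    (fun i (z : jet R unknown) => z.1 0 i) z)) = (fun z => G z.1)); last first.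
  by apply/funext => z; rewrite lincomb_coord.
apply: (jsmooth_comp (G := G)); first by move=> i; exact: jsmooth_coord.
by move=> l z Az; rewrite lincomb_coord; exact: hG.
Qed.

(** By the chain rule the result involves only the D-images of the coordinates and functions of the
    spacetime point. Hence differentiating the shift costs no order. *)
Lemma jsmooth_der_base D r (G : 'rV[R]_4 -> R) : derivation A D ->
  (forall i, jsmooth A r (D (fun z => z.1 0 i))) ->
  (forall l z, A z -> differentiable (iter_derive l G) z.1) ->
  jsmooth A r (D (fun z => G z.1)).
Proof.
move=> hD hc hG.
apply: (@jsmooth_ext _ _ _ _ (\sum_i D (fun z => z.1 0 i)
    * (fun z => 'D_(delta_mx 0 i) G z.1))).
  apply: jsmooth_sum => i _; apply: jsmoothM => //.
  apply: (@jsmooth_base _ ('D_(delta_mx 0 i) G)) => l z Az.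
  by have := hG (rcons l (delta_mx 0 i)) z Az; rewrite /iter_derive foldr_rcons.
move=> z Az; rewrite jsumE -[in RHS](_ : (fun z => G (lincomb (fun i => delta_mx 0 i)
    (fun i (z : jet R unknown) => z.1 0 i) z)) = (fun z => G z.1)); last first.
  by apply/funext => z'; rewrite lincomb_coord.
rewrite (der_comp hD) //.
- by apply: eq_bigr => i _; rewrite lincomb_coord.
- by move=> i; exists (orders 0 0 0); exact: jsmooth_coord.
- by rewrite lincomb_coord; exact: (hG [::]).
Qed.

Lemma derive1_affine (k b : R) : derive1 (fun s => k + s * b) 0 = b.
Proof.
rewrite derive1E; have h : is_derive (0 : R) (1 : R) (fun s : R => k + s * b) b.
  have := is_deriveD (is_derive_cst k (0 : R) (1 : R))
    (is_derive_scale (b : R^o) (is_derive_id (0 : R) (1 : R))).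
  by rewrite add0r scale1r.
by case: h.
Qed.

Lemma Dtot_jvar (U : finType) d u a : Dtot d (@jvar R U u a) = jvar u (mincr d a).
Proof. by apply/funext => z; rewrite /Dtot /jderive /jvar /= derive1_affine. Qed.

Lemma jderive_coord (U : finType) d v i :
  @jderive R U d v (fun z => z.1 0 i) = (fun=> (d == i)%:R).
Proof.
apply/funext => z; rewrite /jderive /=.
under eq_fun do rewrite !mxE.
by rewrite derive1_affine eqxx /= eq_sym.
Qed.

Lemma Aopen : line_open A. Proof. exact: admissible_line_open. Qed.

Lemma Dtot_derivation d : derivation A (Dtot d).
Proof. exact/jderive_derivation/Aopen. Qed.

Lemma Dt_derivation : derivation A (Dt beta).
Proof. exact/jderive_derivation/Aopen. Qed.

(** Written as a sum of multiples of derivations, the shape to which the closure lemmas apply. *)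
Definition hat0_field P : jf R := Dt beta P + \sum_k (- bet beta k) * Ds k P.

Lemma hat0E P : hat0 beta P = hat0_field P.
Proof.
rewrite /hat0 /hat0_field /Lie0 -sumrN; congr (_ + _).
by apply: eq_bigr => k _; rewrite mulNr.
Qed.

Lemma hat0_derivation : derivation A (hat0 beta).
Proof.
have h : derivation A hat0_field.
  apply: derivation_add Dt_derivation _; apply: derivation_sum => k.
  exact/derivation_mul/Dtot_derivation.
by apply: derivation_eq h => P z; rewrite hat0E.
Qed.

Lemma js_bet r k : jsmooth A r (bet beta k).
Proof.
by apply: (@jsmooth_base _ (fun x => beta x 0 k)) => l z [zI _ _]; exact: beta_smooth.
Qed.

Lemma js_Dbet r d k : jsmooth A r (Dtot d (bet beta k)).
Proof.
apply: (@jsmooth_der_base _ _ (fun x => beta x 0 k) (Dtot_derivation d)).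
  by move=> i; rewrite /Dtot jderive_coord; exact: jsmooth_cst.
by move=> l z [zI _ _]; exact: beta_smooth.
Qed.

Lemma js_hat0_coord r i : jsmooth A r (hat0 beta (fun z => z.1 0 i)).
Proof.
rewrite hat0E /hat0_field /Dt jderive_coord; apply: jsmoothD; first exact: jsmooth_cst.
apply: jsmooth_sum => k _; apply: jsmoothM; first exact/jsmoothN/js_bet.
by rewrite /Ds /Dtot jderive_coord; exact: jsmooth_cst.
Qed.

Lemma js_hat0_bet r k : jsmooth A r (hat0 beta (bet beta k)).
Proof.
apply: (@jsmooth_der_base _ _ (fun x => beta x 0 k) hat0_derivation).
  by move=> i; exact: js_hat0_coord.
by move=> l z [zI _ _]; exact: beta_smooth.
Qed.

Lemma jsmooth_Dtot r d P : jsmooth A r P -> jsmooth A (fun u => (r u).+1) (Dtot d P).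
Proof.
move=> hP; apply: (jsmooth_derivation (Dtot_derivation d) _ _ _ hP) => //.
- by move=> i; rewrite /Dtot jderive_coord; exact: jsmooth_cst.
- by move=> u a ha; rewrite Dtot_jvar; apply: jsmooth_jvar; rewrite mdeg_mincr.
Qed.

Lemma js_Dtot p q s d P : js p q s P -> js p.+1 q.+1 s.+1 (Dtot d P).
Proof. by move=> /(@jsmooth_Dtot _ d); apply: jsmoothW => -[[u|u]|u]. Qed.

Lemma js_Ds p q s k P : js p q s P -> js p.+1 q.+1 s.+1 (Ds k P).
Proof. exact: js_Dtot. Qed.

(* The reduced time derivative of [g_a] is transport along [beta] up to terms
   of order [|a|], so [hat0] does not raise the order in [g]. *)
Lemma Dmulti_gdot a i j : jsmooth A (fun=> mdeg a)
  (Dmulti a (gdot beta i j)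
   - \sum_k bet beta k * jvar (Ug (sidx i j)) (mincr (sp k) a)).
Proof.
pose X b : jf R := \sum_k bet beta k * jvar (Ug (sidx i j)) (mincr (sp k) b).
pose good b (Q : jf R) := jsmooth A (fun=> mdeg b) (Q - X b).
have sX b : smooth A (X b).
  exists (fun=> (mdeg b).+1); apply: jsmooth_sum => k _; apply: jsmoothM.
    exact: js_bet.
  by apply: jsmooth_jvar; rewrite mdeg_mincr.
have step d b Q : good b Q -> good (mincr d b) (Dtot d Q).
  move=> hQ; have := @jsmooth_Dtot _ d _ hQ => hD.
  rewrite /good mdeg_mincr.
  (* [Y] collects the terms in which the derivative falls on the shift; their order is |b| + 1, so
     they are absorbed. *)
  pose Y : jf R := \sum_k Dtot d (bet beta k) * jvar (Ug (sidx i j)) (mincr (sp k) b).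
  apply: (@jsmooth_ext _ _ _ _ (Dtot d (Q - X b) + Y)).
    apply: jsmoothD hD _; apply: jsmooth_sum => k _; apply: jsmoothM.
      exact: js_Dbet.
    by apply: jsmooth_jvar; rewrite mdeg_mincr.
  have sQ : smooth A Q.
    have -> : Q = (Q - X b) + X b by rewrite subrK.
    by apply: smoothD (sX b); exists (fun=> mdeg b).
  move=> z Az; rewrite !jE (derB (Dtot_derivation d)) // -addrA; congr (_ + _).
  rewrite /X (der_sum (Dtot_derivation d)) //; last first.
    move=> k; apply: smoothM; first by exists (fun=> 0%N); exact: js_bet.
    by exists (fun=> (mdeg b).+1); apply: jsmooth_jvar; rewrite mdeg_mincr.
  rewrite /Y !jsumE addrC -sumrB -sumrN; apply: eq_bigr => k _.
  rewrite (derM (Dtot_derivation d)) //; last first.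
  - by exists (fun=> (mdeg b).+1); apply: jsmooth_jvar; rewrite mdeg_mincr.
  - by exists (fun=> 0%N); exact: js_bet.
  by rewrite Dtot_jvar mincrC !jE; ring.
have iterstep n d b Q : good b Q -> good (iter n (mincr d) b) (iter n (Dtot d) Q).
  by move=> hQ; elim: n => //= n; exact: step.
suff : good a (Dmulti a (gdot beta i j)) by [].
rewrite -{1}(foldr_mincr a) /Dmulti.
have : good midx0 (gdot beta i j).
  rewrite /good /gdot mdeg0 /X /Lie2.
  (* Without derivatives, the difference from transport consists of the remaining terms of the Lie
     derivative and of -2 N K, all of order zero in the unknowns. *)
  pose Z : jf R := \sum_k (Ds i (bet beta k) * gd k j
     + Ds j (bet beta k) * gd i k) - 2%:R *: (N (R := R) * Kd i j).
  apply: (@jsmooth_ext _ _ _ _ Z).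
    have h u : jsmooth A (fun=> 0%N) (jvar u midx0).
      by apply: jsmooth_jvar; rewrite mdeg0.
    apply: jsmoothB.
      apply: jsmooth_sum => k _; apply: jsmoothD;
        apply: jsmoothM; [exact: js_Dbet|exact: h|exact: js_Dbet|exact: h].
    by apply: jsmoothZ; apply: jsmoothM; exact: h.
  move=> z _; rewrite /Z !jE addrAC; congr (_ - _).
  rewrite -sumrB; apply: eq_bigr => k _; rewrite /Ds Dtot_jvar !jE; ring.
by elim: (enum 'I_4) => //= d l IH h; apply: iterstep; exact: IH.
Qed.

Lemma sidx_val (p : sym_idx) : sidx (val p).1 (val p).2 = p.
Proof.
case: p => -[i j] /= ij; apply: val_inj; rewrite /sidx ij val_insubd /=.
by rewrite ij.
Qed.

(* hat-d_0 = nu^d D_d on K and N *)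
Definition nu (d : 'I_4) : jf R :=
  if unlift ord0 d is Some k then - bet beta k else 1.

Lemma js_nu r d : jsmooth A r (nu d).
Proof.
rewrite /nu; case: unliftP => [k _|_]; last exact: jsmooth_cst.
exact/jsmoothN/js_bet.
Qed.

Lemma sum_nu (f : 'I_4 -> jf R) :
  \sum_d nu d * f d = f ord0 + \sum_k (- bet beta k) * f (sp k).
Proof.
rewrite big_ord_recl {1}/nu unlift_none mul1r; congr (_ + _).
by apply: eq_bigr => k _; rewrite /nu liftK.
Qed.

Definition is_g (u : unknown) := if u is inl (inl _) then true else false.

Lemma hat0_jvar u a : ~~ is_g u ->
  hat0 beta (jvar u a) = \sum_d nu d * jvar u (mincr d a).
Proof.
move=> ug; rewrite hat0E /hat0_field sum_nu; congr (_ + _).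
  apply/funext => z; rewrite /Dt /jderive /jvar /= derive1_affine.
  by case: u ug => // -[].
by apply: eq_bigr => k _; rewrite /Ds Dtot_jvar.
Qed.

(** The transport term isolated in [Dmulti_gdot] is exactly the one that [hat0] subtracts. The
    remainder involves K and N too, hence a bound common to all unknowns. *)
Lemma js_hat0_g a p : jsmooth A (fun=> mdeg a) (hat0 beta (jvar (Ug p) a)).
Proof.
have := Dmulti_gdot a (val p).1 (val p).2; rewrite sidx_val => h.
apply: (jsmooth_ext h) => z _; rewrite hat0E /hat0_field !jE; congr (_ + _).
  by rewrite /Dt /jderive /jvar /= derive1_affine.
by rewrite -sumrN; apply: eq_bigr => k _; rewrite /Ds Dtot_jvar !jE mulNr.
Qed.

Lemma js_hat0_jvar r u a : ~~ is_g u -> (mdeg a < r u)%N ->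
  jsmooth A r (hat0 beta (jvar u a)).
Proof.
move=> ug ha; rewrite hat0_jvar //; apply: jsmooth_sum => d _.
apply: jsmoothM; first exact: js_nu.
by apply: jsmooth_jvar; rewrite mdeg_mincr.
Qed.

(** Derivatives of g of order up to p produce derivatives of K and N of the same order, which must
    fit below q + 1 and s + 1. *)
Lemma js_hat0 p q s P : js p q s P -> (p <= q.+1)%N -> (p <= s.+1)%N ->
  js p q.+1 s.+1 (hat0 beta P).
Proof.
move=> hP pq ps; apply: (jsmooth_derivation hat0_derivation _ _ _ hP).
- by move=> [[u|u]|u] //=.
- by move=> i; exact: js_hat0_coord.
- move=> u a; case: (boolP (is_g u)) => [|ug ha].
    case: u => [[u|u]|u] //= _ ap; apply: jsmoothW (js_hat0_g a u).
    by move=> [[v|v]|v] //=; apply: leq_trans ap _.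
  by apply: js_hat0_jvar => //; case: u ug ha => [[u|u]|u].
Qed.

(** Either composite alone may raise the orders in K and N by two; the commutator raises them by
    one. *)
Lemma js_commutator p q s i P : js p q s P -> (p <= q)%N -> (p <= s)%N ->
  js p.+1 q.+1 s.+1 (hat0 beta (Ds i P) - Ds i (hat0 beta P)).
Proof.
move=> hP pq ps.
apply: (jsmooth_commutator hat0_derivation (Dtot_derivation (sp i)) _ _ _ _ _ hP).
- by move=> [[u|u]|u] /=.
- move=> Q hQ; apply: jsW (js_hat0 hQ _ _) _ _ _ => //; exact: leqW.
- by move=> Q; exact: js_Ds.
- move=> d; apply: jsmoothB.
    rewrite /Dtot jderive_coord.
    apply: (jsmooth_ext (jsmooth_cst A _ 0)) => z Az.
    by rewrite (der_cst hat0_derivation).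
  have h : js p q s (hat0 beta (fun z => z.1 0 d)) by exact: js_hat0_coord.
  exact: js_Dtot h.
- move=> u a; case: (boolP (is_g u)) => [|ug ha].
    (* For variables of g no cancellation is required: each composite has order |a| + 1, because
       [hat0] does not raise it. *)
    case: u => [[u|u]|u] //= _ ap; rewrite Dtot_jvar; apply: jsmoothB.
      apply: jsmoothW (js_hat0_g _ u) => -[[v|v]|v]; rewrite mdeg_mincr ltnS //=.
        exact: leq_trans ap _.
      exact: leq_trans ap _.
    have := jsmooth_Dtot (sp i) (js_hat0_g a u).
    by apply: jsmoothW => -[[v|v]|v]; rewrite ltnS //=; apply: leq_trans ap _.
  (* For K and N the second derivatives cancel, since jet derivatives commute; only derivatives of
     the shift times first derivatives remain. *)
  apply: (@jsmooth_ext _ _ _ _ (- \sum_d Dtot (sp i) (nu d) * jvar u (mincr d a))).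
    apply/jsmoothN/jsmooth_sum => d _; apply: jsmoothM; last first.
      by apply: jsmooth_jvar; rewrite mdeg_mincr; case: u ug ha => [[u|u]|u].
    rewrite /nu; case: unliftP => [k _|_].
      apply: (@jsmooth_ext _ _ _ _ (- Dtot (sp i) (bet beta k))).
        exact/jsmoothN/js_Dbet.
      move=> z Az; rewrite (derN (Dtot_derivation _)) //.
      by exists (fun=> 0%N); exact: js_bet.
    apply: (jsmooth_ext (jsmooth_cst A _ 0)) => z Az.
    by rewrite (der_cst (Dtot_derivation _)).
  move=> z Az; rewrite Dtot_jvar !hat0_jvar //.
  have sn d : smooth A (nu d) by exists (fun=> 0%N); exact: js_nu.
  have sj d : smooth A (jvar u (mincr d a)).
    by exists (fun=> (mdeg a).+1); apply: jsmooth_jvar; rewrite mdeg_mincr.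
  rewrite !jE (der_sum (Dtot_derivation _)) //; last by move=> d; exact: smoothM.
  rewrite -sumrN -sumrB; apply: eq_bigr => d _.
  rewrite (derM (Dtot_derivation _)) // Dtot_jvar mincrC !jE; ring.
Qed.

End TimeDerivative.

(** * Orders of the geometric quantities *)

Section SourceArg.
Variable R : realType.

(** The blocks are the spacetime point, N, the entries of g and of K, and the first derivatives of
    N. They make F a function of finitely many scalar jet functions. *)
Definition source_index : finType :=
  ('I_4 + 'I_1 + ('I_3 * 'I_3) + ('I_3 * 'I_3) + 'I_4)%type.

Definition source_dir (i : source_index) : @source_arg R :=
  match i with
  | inl (inl (inl (inl m))) => (delta_mx 0 m, 0, 0, 0, 0)
  | inl (inl (inl (inr _))) => (0, 1, 0, 0, 0)
  | inl (inl (inr p)) => (0, 0, delta_mx p.1 p.2, 0, 0)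
  | inl (inr p) => (0, 0, 0, delta_mx p.1 p.2, 0)
  | inr m => (0, 0, 0, 0, delta_mx 0 m)
  end.

Definition source_coord (i : source_index) : jf R :=
  match i with
  | inl (inl (inl (inl m))) => fun z => z.1 0 m
  | inl (inl (inl (inr _))) => N (R := R)
  | inl (inl (inr p)) => gd p.1 p.2
  | inl (inr p) => Kd p.1 p.2
  | inr m => jvar UN (mincr m midx0)
  end.

Lemma lincomb_source z : lincomb source_dir source_coord z
  = (z.1, N z, gmx z, Kmx z, \row_mu Dtot mu (N (R := R)) z).
Proof.
have mxE2 (B : 'M[R]_3) : \sum_(p : 'I_3 * 'I_3) B p.1 p.2 *: delta_mx p.1 p.2 = B.
  by rewrite {2}[B]matrix_sum_delta pair_bigA.
have sum0 (I : finType) (f : I -> R) (V : lmodType R) : \sum_i f i *: (0 : V) = 0.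
  by rewrite big1 // => i _; rewrite scaler0.
set s := lincomb _ _ _.
rewrite [s](_ : _ = (s.1.1.1.1, s.1.1.1.2, s.1.1.2, s.1.2, s.2)); last first.
  by case: (s) => [[[[? ?] ?] ?] ?].
congr (_, _, _, _, _); rewrite {}/s /lincomb.
(* Each projection is additive and annihilates all blocks of directions but its own. *)
- rewrite (big_morph (fun a : @source_arg R => a.1.1.1.1) (id1 := 0) (op1 := +%R)) //.
  rewrite !big_sumType /= !sum0 !addr0 ?add0r.
  by rewrite -row_sum_delta.
- rewrite (big_morph (fun a : @source_arg R => a.1.1.1.2) (id1 := 0) (op1 := +%R)) //.
  rewrite !big_sumType /= !sum0 !addr0 ?add0r.
  by rewrite big_ord1 [LHS]mulr1.
- rewrite (big_morph (fun a : @source_arg R => a.1.1.2) (id1 := 0) (op1 := +%R)) //.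
  rewrite !big_sumType /= !sum0 !addr0 ?add0r.
  rewrite -[RHS]mxE2; apply: eq_bigr => p _; by rewrite mxE.
- rewrite (big_morph (fun a : @source_arg R => a.1.2) (id1 := 0) (op1 := +%R)) //.
  rewrite !big_sumType /= !sum0 !addr0 ?add0r.
  rewrite -[RHS]mxE2; apply: eq_bigr => p _; by rewrite mxE.
- rewrite (big_morph (fun a : @source_arg R => a.2) (id1 := 0) (op1 := +%R)) //.
  rewrite !big_sumType /= !sum0 !addr0 ?add0r.
  rewrite [RHS]row_sum_delta; apply: eq_bigr => m _; by rewrite mxE Dtot_jvar.
Qed.

End SourceArg.

Section Geometry.
Variables (R : realType) (M : manifold3 R) (c : chart M).
Local Notation A := (@admissible R M c).
Local Notation js p q s := (jsmooth A (orders p q s)).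
Implicit Types (P Q : jf R) (T : tensor2 R) (p q s : nat).

Lemma js_jvar p q s u : js p q s (jvar u midx0).
Proof. by apply: jsmooth_jvar; rewrite mdeg0. Qed.

Lemma js_gd p q s i j : js p q s (gd i j). Proof. exact: js_jvar. Qed.
Lemma js_Kd p q s i j : js p q s (Kd i j). Proof. exact: js_jvar. Qed.
Lemma js_N p q s : js p q s (N (R := R)). Proof. exact: js_jvar. Qed.

Lemma N_neq0 z : A z -> N z != 0.
Proof. by move=> [_ /gt_eqF->]. Qed.

Lemma js_Ninv p q s : js p q s (Ninv (R := R)).
Proof. by apply: jsmoothV; [exact: js_N|exact: N_neq0]. Qed.

Lemma jsmooth_det r n (B : 'I_n -> 'I_n -> jf R) :
  (forall i j, jsmooth A r (B i j)) ->
  jsmooth A r (fun z => \det (\matrix_(i, j) B i j z)).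
Proof.
move=> hB; pose D : jf R := \sum_(t : 'S_n) (-1) ^+ t *: \prod_i B i (t i).
apply: (@jsmooth_ext _ _ _ _ D).
  by apply: jsmooth_sum => t _; apply: jsmoothZ; exact: jsmooth_prod.
move=> z _; rewrite /D !jE /determinant; apply: eq_bigr => t _.
rewrite jE; congr (_ * _).
transitivity (\prod_i B i (t i) z); last by apply: eq_bigr => i _; rewrite mxE.
by elim/big_rec2: _ => // i y1 y2 _ <-.
Qed.

(** Cramer's rule: the adjugate is polynomial in g, and the determinant does not vanish on
    admissible jets. *)
Lemma js_gu p q s i j : js p q s (gu i j).
Proof.
have hd : js p q s (fun z => \det (gmx z)).
  by apply: jsmooth_det => *; exact: js_gd.
have d0 z : A z -> \det (gmx z) != 0 by move=> [_ _]; exact: posdef_det_neq0.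
have ha : js p q s (fun z => (\adj (gmx z)) i j).
  pose D : jf R := (-1) ^+ (j + i) *: (fun z => \det (\matrix_(a, b) gd (lift j a) (lift i b) z)).
  apply: (@jsmooth_ext _ _ _ _ D).
    by apply: jsmoothZ; apply: jsmooth_det => *; exact: js_gd.
  move=> z _; rewrite mxE /cofactor /D; congr (_ * \det _).
  by apply/matrixP => a b; rewrite !mxE.
apply: (jsmooth_ext (jsmoothM (jsmoothV hd d0) ha)) => z Az.
(* Off the invertible matrices [invmx] returns its argument, so the nonvanishing determinant is what
   selects the adjugate formula. *)
by rewrite /gu /invmx unitmxE unitfE d0 // mxE.
Qed.

(** The generic [js_Ds] raises all three orders. Differentiating a single unknown raises only its
    own, and the bounds on C_ij and the principal parts depend on this precision. *)
Lemma js_Dgd p q s k i j : js p.+1 q s (Ds k (gd i j)).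
Proof. by rewrite /Ds Dtot_jvar; apply: jsmooth_jvar; rewrite mdeg_mincr mdeg0. Qed.

Lemma js_DKd p q s k i j : js p q.+1 s (Ds k (Kd i j)).
Proof. by rewrite /Ds Dtot_jvar; apply: jsmooth_jvar; rewrite mdeg_mincr mdeg0. Qed.

Lemma js_DN p q s k : js p q s.+1 (Ds k (N (R := R))).
Proof. by rewrite /Ds Dtot_jvar; apply: jsmooth_jvar; rewrite mdeg_mincr mdeg0. Qed.

Lemma js_DN2 p q s k : js p q s.+1 (Ds k (N (R := R) ^+ 2)).
Proof.
have h := jsmoothM (js_DN p q s k) (js_N p q s.+1).
apply: (jsmooth_ext (jsmoothD h h)) => z Az.
rewrite /Ds expr2 (derM (Dtot_derivation c _)) //; try exact: (js_smooth (js_N 0 0 0)).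
by rewrite !jE; congr (_ + _); rewrite mulrC.
Qed.

Lemma js_Gam p q s k i j : js p.+1 q s (Gam k i j).
Proof.
apply: jsmoothZ; apply: jsmooth_sum => l _; apply: jsmoothM; first exact: js_gu.
by apply: jsmoothB; [apply: jsmoothD|]; exact: js_Dgd.
Qed.

Lemma js_cov0 p q s P i : js p q s P -> js p.+1 q.+1 s.+1 (cov0 P i).
Proof. exact: js_Ds. Qed.

Lemma jsS p q s P : js p q s P -> js p.+1 q.+1 s.+1 P.
Proof. by move=> /jsW; apply. Qed.

Lemma js_cov1 p q s (V : tensor1 R) i j : (forall k, js p q s (V k)) ->
  js p.+1 q.+1 s.+1 (cov1 V i j).
Proof.
move=> hV; apply: jsmoothB; first exact: js_Ds.
by apply: jsmooth_sum => k _; apply: jsmoothM; [exact: js_Gam|exact: jsS].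
Qed.

Lemma js_cov2 p q s T k i j : (forall i j, js p q s (T i j)) ->
  js p.+1 q.+1 s.+1 (cov2 T k i j).
Proof.
move=> hT; apply: jsmoothB; [apply: jsmoothB; first exact: js_Ds|];
  by apply: jsmooth_sum => l _; apply: jsmoothM; [exact: js_Gam|exact: jsS].
Qed.

Lemma js_cov11 p q s T k i j : (forall i j, js p q s (T i j)) ->
  js p.+1 q.+1 s.+1 (cov11 T k i j).
Proof.
move=> hT; apply: jsmoothB; [apply: jsmoothD; first exact: js_Ds|];
  by apply: jsmooth_sum => l _; apply: jsmoothM; [exact: js_Gam|exact: jsS].
Qed.

Lemma js_cov3 p q s (T : tensor3 R) k i j l : (forall i j l, js p q s (T i j l)) ->
  js p.+1 q.+1 s.+1 (cov3 T k i j l).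
Proof.
move=> hT; apply: jsmoothB; [apply: jsmoothB; [apply: jsmoothB; first exact: js_Ds|]|];
  by apply: jsmooth_sum => m _; apply: jsmoothM; [exact: js_Gam|exact: jsS].
Qed.

Lemma js_sym p q s T i j : (forall i j, js p q s (T i j)) -> js p q s (sym T i j).
Proof. by move=> hT; apply: jsmoothZ; apply: jsmoothD. Qed.

Lemma js_hess p q s P i j : js p q s P -> js p.+2 q.+2 s.+2 (hess P i j).
Proof. by move=> hP; apply: js_cov1 => k; exact: js_cov0. Qed.

Lemma js_Riem p q s i j k l : js p.+2 q.+1 s.+1 (Riem i j k l).
Proof.
apply: jsmoothD; first by apply: jsmoothB; apply: js_Ds; exact: js_Gam.
by apply: jsmooth_sum => m _; apply: jsmoothB; apply: jsmoothM; exact: js_Gam.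
Qed.

Lemma js_Ric p q s i j : js p.+2 q.+1 s.+1 (Ric i j).
Proof. by apply: jsmooth_sum => k _; exact: js_Riem. Qed.

Lemma js_Riemd p q s i j k l : js p.+2 q.+1 s.+1 (Riemd i j k l).
Proof.
by apply: jsmooth_sum => m _; apply: jsmoothM; [exact: js_gd|exact: js_Riem].
Qed.

Lemma js_Km p q s i j : js p q s (Km i j).
Proof.
by apply: jsmooth_sum => m _; apply: jsmoothM; [exact: js_gu|exact: js_Kd].
Qed.

Lemma js_Ku p q s i j : js p q s (Ku i j).
Proof.
by apply: jsmooth_sum => m _; apply: jsmoothM; [exact: js_Km|exact: js_gu].
Qed.

Lemma js_H p q s : js p q s (H (R := R)).
Proof. by apply: jsmooth_sum => m _; exact: js_Km. Qed.

Lemma js_cov0N p q s i : js p q s.+1 (cov0 (N (R := R)) i).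
Proof. exact: js_DN. Qed.

Lemma js_Nu p q s i : js p q s.+1 (Nu i).
Proof.
by apply: jsmooth_sum => m _; apply: jsmoothM; [exact: js_gu|exact: js_cov0N].
Qed.

Section Time.
Variable beta : 'rV[R]_4 -> 'rV[R]_3.
Hypothesis beta_smooth : forall k, smooth_on
  [set x : 'rV[R]_4 | spatial_image c (spat x)] (fun x => beta x 0 k).

(** Componentwise, [hat2] is [hat0] up to terms that do not differentiate T; this reduces tensors to
    scalars in all order counts. *)
Lemma hat2E T i j : hat2 beta T i j = hat0 beta (T i j)
  - \sum_k (Ds i (bet beta k) * T k j + Ds j (bet beta k) * T i k).
Proof.
rewrite /hat2 /hat0 -addrA -opprD /Lie0 -big_split; congr (_ - _).
by apply: eq_bigr => k _ /=; rewrite addrA.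
Qed.

Lemma js_hat2_zero p q s T i j : (forall i j, js p q s (T i j)) ->
  js p q s (\sum_k (Ds i (bet beta k) * T k j + Ds j (bet beta k) * T i k)).
Proof.
move=> hT; apply: jsmooth_sum => k _.
by apply: jsmoothD; apply: jsmoothM => //; exact: (js_Dbet beta_smooth).
Qed.

Lemma js_hat2 p q s T i j : (forall i j, js p q s (T i j)) -> (p <= q.+1)%N ->
  (p <= s.+1)%N -> js p q.+1 s.+1 (hat2 beta T i j).
Proof.
move=> hT pq ps; rewrite hat2E; apply: jsmoothB; first exact: (js_hat0 beta_smooth).
by apply: js_hat2_zero => ? ?; apply: jsW (hT _ _) _ _ _.
Qed.

Lemma js_hat0N p q s : js p q s.+1 (hat0 beta (N (R := R))).
Proof. by apply: (js_hat0_jvar beta_smooth) => //; rewrite mdeg0. Qed.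

End Time.
End Geometry.

(** The sharp rules for individual quantities precede the generic ones, which are tried only when no
    sharp rule closes the goal. *)
Ltac js beta_smooth :=
  repeat match goal with
  | |- jsmooth _ _ (Ds _ (gd _ _)) => exact: js_Dgd
  | |- jsmooth _ _ (Ds _ (Kd _ _)) => exact: js_DKd
  | |- jsmooth _ _ (Ds _ (@N _)) => exact: js_DN
  | |- jsmooth _ _ (cov0 (@N _) _) => exact: js_cov0N
  | |- jsmooth _ _ (cov0 (@N _ ^+ 2) _) => exact: js_DN2
  | |- jsmooth _ _ (Ds _ (@N _ ^+ 2)) => exact: js_DN2
  | |- jsmooth _ _ (hat0 _ (@N _)) => exact: (js_hat0N beta_smooth)
  | |- jsmooth _ _ (gd _ _) => exact: js_gd
  | |- jsmooth _ _ (Kd _ _) => exact: js_Kd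
  | |- jsmooth _ _ (gu _ _) => exact: js_gu
  | |- jsmooth _ _ (@N _) => exact: js_N
  | |- jsmooth _ _ (@Ninv _) => exact: js_Ninv
  | |- jsmooth _ _ (@H _) => exact: js_H
  | |- jsmooth _ _ (Km _ _) => exact: js_Km
  | |- jsmooth _ _ (Ku _ _) => exact: js_Ku
  | |- jsmooth _ _ (Nu _) => exact: js_Nu
  | |- jsmooth _ _ (Gam _ _ _) => exact: js_Gam
  | |- jsmooth _ _ (Ric _ _) => exact: js_Ric
  | |- jsmooth _ _ (Riemd _ _ _ _) => exact: js_Riemd
  | |- jsmooth _ _ (hess _ _ _) => apply: js_cov1 => ?
  | |- jsmooth _ _ (cov1 _ _ _) => apply: js_cov1 => ?
  | |- jsmooth _ _ (cov2 _ _ _ _) => apply: js_cov2 => ? ?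
  | |- jsmooth _ _ (cov11 _ _ _ _) => apply: js_cov11 => ? ?
  | |- jsmooth _ _ (cov3 _ _ _ _ _) => apply: js_cov3 => ? ? ?
  | |- jsmooth _ _ (sym _ _ _) => apply: js_sym => ? ?
  | |- jsmooth _ _ (hat0 _ _) => apply: (js_hat0 beta_smooth) => //
  | |- jsmooth _ _ (hat2 _ _ _ _) => apply: (js_hat2 beta_smooth) => // ? ?
  | |- jsmooth _ _ (cov0 _ _) => apply: js_cov0
  | |- jsmooth _ _ (Ds _ _) => apply: js_Ds
  | |- jsmooth _ _ (- _) => apply: jsmoothN
  | |- jsmooth _ _ (_ + _) => apply: jsmoothD
  | |- jsmooth _ _ (_ * _) => apply: jsmoothM
  | |- jsmooth _ _ (_ *: _) => apply: jsmoothZ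
  | |- jsmooth _ _ (_ ^+ _) => apply: jsmoothX
  | |- jsmooth _ _ (\sum_(_ <- _ | _) _) => apply: jsmooth_sum => ? _
  end.

(** * Order bounds for the source, for J_ij and for the wave operator on K *)

Section Reduced.
Variables (R : realType) (M : manifold3 R) (c : chart M).
Variables (beta : 'rV[R]_4 -> 'rV[R]_3) (F : @source_arg R -> R).
Hypothesis beta_smooth : forall k, smooth_on
  [set x : 'rV[R]_4 | spatial_image c (spat x)] (fun x => beta x 0 k).
Hypothesis F_smooth : smooth_on
  [set a : @source_arg R | let: (x, N, g, K, q) := a in
     [/\ spatial_image c (spat x), 0 < N & posdef g]] F.
Local Notation A := (@admissible R M c).
Local Notation js p q s := (jsmooth A (orders p q s)).
Implicit Types (P Q : jf R) (T : tensor2 R) (p q s : nat).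

Lemma js_Fj p q s : js p q s.+1 (Fj F).
Proof.
rewrite /Fj (_ : (fun z => _) = fun z => F (lincomb (@source_dir R) (@source_coord R) z)).
  apply: (jsmooth_comp (G := F)).
    move=> [[[[m|m]|i]|i]|m] /=; rewrite ?/N ?/gd ?/Kd;
      try by apply: jsmooth_jvar; rewrite ?mdeg_mincr mdeg0.
    exact: jsmooth_coord.
  by move=> l z [z1 z2 z3]; rewrite lincomb_source; exact: F_smooth.
by apply/funext => z; rewrite lincomb_source.
Qed.

(** The bounds (2, 1, 2) violate the side condition of [js_hat2]. The time-derivative term is
    therefore first estimated by (0, 1, 1), as its argument contains no derivative of g. *)
Lemma js_Jt i j : js 2 1 2 (Jt beta i j).
Proof. rewrite /Jt; js beta_smooth; apply: jsW (_ : js 0 1 1 _) _ _ _ => //; js beta_smooth. Qed.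

Lemma js_Box2_time i j :
  js 0 2 2 (Ninv (R := R) * hat2 beta (fun i' j' => Ninv (R := R) * hat2 beta (@Kd R) i' j') i j).
Proof. js beta_smooth. Qed.

Lemma js_Box2 i j : js 2 2 2 (Box2 beta (@Kd R) i j).
Proof.
apply: jsmoothD; first by apply: jsmoothN; apply: jsW (js_Box2_time i j) _ _ _.
js beta_smooth.
Qed.

Lemma js_hessF i j : js 2 2 3
  (hess (N (R := R) * Fj F - N (R := R) ^+ 2 * \sum_m \sum_k Ku m k * Kd m k) i j).
Proof.
apply: js_hess (_ : js 0 0 1 _); apply: jsmoothB; last by js beta_smooth.
by apply: jsmoothM; [exact: js_N|exact: js_Fj].
Qed.

End Reduced.

(** * Congruence modulo lower order and the order of f_ij *)

Section EqMod.
Variables (R : realType) (U : finType) (A : set (jet R U)).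
Implicit Types (P Q n : jfun R U) (r : U -> nat).

(** The difference has to lie in the smooth class, not merely to depend on few derivatives, so that
    congruences can be differentiated. *)
Definition eqmod r P Q := jsmooth A r (P - Q).

Lemma eqmod_eq r P Q : (forall z, A z -> P z = Q z) -> eqmod r P Q.
Proof.
move=> PQ; apply: (jsmooth_ext (jsmooth_cst A r 0)) => z Az.
by rewrite !jE PQ // subrr.
Qed.

Lemma eqmod_refl r P : eqmod r P P. Proof. exact: eqmod_eq. Qed.

Lemma eqmod_sym r P Q : eqmod r P Q -> eqmod r Q P.
Proof. by move=> h; rewrite /eqmod -opprB; exact: jsmoothN. Qed.

Lemma eqmod_trans r P Q S : eqmod r P Q -> eqmod r Q S -> eqmod r P S.
Proof.
move=> h h'; rewrite /eqmod (_ : P - S = (P - Q) + (Q - S)); first exact: jsmoothD.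
by rewrite addrA subrK.
Qed.

Lemma eqmodD r P Q P' Q' : eqmod r P Q -> eqmod r P' Q' -> eqmod r (P + P') (Q + Q').
Proof. by move=> h h'; rewrite /eqmod opprD addrACA; exact: jsmoothD. Qed.

Lemma eqmodM r n P Q : jsmooth A r n -> eqmod r P Q -> eqmod r (n * P) (n * Q).
Proof. by move=> hn h; rewrite /eqmod -mulrBr; exact: jsmoothM. Qed.

Lemma eqmodN r P Q : eqmod r P Q -> eqmod r (- P) (- Q).
Proof. by move=> h; rewrite /eqmod -opprD; exact: jsmoothN. Qed.

Lemma eqmod_sum r (I : Type) (l : seq I) (f g : I -> jfun R U) :
  (forall i, eqmod r (f i) (g i)) -> eqmod r (\sum_(i <- l) f i) (\sum_(i <- l) g i).
Proof.
by move=> h; rewrite /eqmod -sumrB; apply: jsmooth_sum => i _; exact: h.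
Qed.

Lemma eqmod_addr r P Q : jsmooth A r Q -> eqmod r (P + Q) P.
Proof. by move=> h; rewrite /eqmod addrAC subrr add0r. Qed.

Lemma eqmod_subr r P Q : jsmooth A r Q -> eqmod r (P - Q) P.
Proof. by move=> h; apply: eqmod_addr; exact: jsmoothN. Qed.

Lemma eqmod_der D r r' P Q : derivation A D ->
  (forall P, jsmooth A r P -> jsmooth A r' (D P)) -> smooth A Q ->
  eqmod r P Q -> eqmod r' (D P) (D Q).
Proof.
move=> hD hr sQ PQ; apply: (jsmooth_ext (hr _ PQ)) => z Az.
have sP : smooth A P.
  by rewrite -(subrK Q P); apply: smoothD => //; exists r.
by rewrite (derB hD).
Qed.

Lemma eqmod_derM D r n P : derivation A D -> smooth A n -> smooth A P ->
  jsmooth A r (D n * P) -> eqmod r (D (n * P)) (n * D P).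
Proof.
move=> hD sn sP h; apply: (jsmooth_ext h) => z Az.
by rewrite !jE (derM hD) //; ring.
Qed.

Lemma eqmod_derD D r P Q : derivation A D -> smooth A P -> smooth A Q ->
  eqmod r (D (P + Q)) (D P + D Q).
Proof. by move=> hD sP sQ; apply: eqmod_eq => z Az; exact: (derD hD). Qed.

End EqMod.

(** * The cancellation inside C_ij and the order of f_ij *)

Section Curvature.
Variables (R : realType) (M : manifold3 R) (c : chart M).
Variables (beta : 'rV[R]_4 -> 'rV[R]_3) (F : @source_arg R -> R).
Hypothesis beta_smooth : forall k, smooth_on
  [set x : 'rV[R]_4 | spatial_image c (spat x)] (fun x => beta x 0 k).
Hypothesis F_smooth : smooth_on
  [set a : @source_arg R | let: (x, N, g, K, q) := a in
     [/\ spatial_image c (spat x), 0 < N & posdef g]] F.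
Local Notation A := (@admissible R M c).
Local Notation js p q s := (jsmooth A (orders p q s)).
Local Notation eqm p q s := (eqmod A (orders p q s)).
Local Notation N := (N (R := R)).
Local Notation Ninv := (Ninv (R := R)).
Local Notation H := (H (R := R)).
Local Notation hat0 := (hat0 beta).
Implicit Types (P Q n W : jf R) (T : tensor2 R) (p q s : nat).

(** With one bound common to all unknowns, the side conditions of [js_hat0] hold automatically. *)
Lemma smooth_js P : smooth A P -> exists m, js m m m P.
Proof.
move=> [r hr]; exists (\max_u r u)%N; apply: jsmoothW hr => u.
by case: u => [[u|u]|u]; exact: leq_bigmax.
Qed.

Lemma smooth_hat0 P : smooth A P -> smooth A (hat0 P).
Proof.
move=> /smooth_js[m hm]; exists (orders m m.+1 m.+1); exact: (js_hat0 beta_smooth).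
Qed.

Lemma smooth_Ds i P : smooth A P -> smooth A (Ds i P).
Proof.
by move=> /smooth_js[m hm]; exists (orders m.+1 m.+1 m.+1); exact: js_Ds.
Qed.

Lemma eqm_Ds p q s i P Q : smooth A Q -> eqm p q s P Q ->
  eqm p.+1 q.+1 s.+1 (Ds i P) (Ds i Q).
Proof.
by move=> sQ; apply: eqmod_der (Dtot_derivation c _) _ sQ => ?; exact: js_Ds.
Qed.

Lemma eqm_hat0 p q s P Q : smooth A Q -> (p <= q.+1)%N -> (p <= s.+1)%N ->
  eqm p q s P Q -> eqm p q.+1 s.+1 (hat0 P) (hat0 Q).
Proof.
move=> sQ pq ps; apply: eqmod_der (hat0_derivation c _) _ sQ => ? ?.
exact: (js_hat0 beta_smooth).
Qed.

Lemma js_hat0Ninv p q s : js p q s.+1 (hat0 Ninv).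
Proof.
apply: (@jsmooth_ext _ _ _ _ (- Ninv * Ninv * hat0 N)); first by js beta_smooth.
move=> z Az; rewrite (derV (hat0_derivation c _)) //; last exact: N_neq0.
  by rewrite !jE /Ninv expr2 invfM; ring.
exact: (js_smooth (js_N c 0 0 0)).
Qed.

Lemma smooth_N : smooth A N. Proof. exact: (js_smooth (js_N c 0 0 0)). Qed.
Lemma smooth_Ninv : smooth A Ninv. Proof. exact: (js_smooth (js_Ninv c 0 0 0)). Qed.
Lemma smooth_H : smooth A H. Proof. exact: (js_smooth (js_H c 0 0 0)). Qed.

Ltac sm := repeat match goal with
  | |- smooth _ (_ + _) => apply: smoothD
  | |- smooth _ (_ * _) => apply: smoothM
  | |- smooth _ (_ ^+ 2) => rewrite expr2; apply: smoothM
  | |- smooth _ (hat0 _) => apply: smooth_hat0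
  | |- smooth _ (Ds _ _) => apply: smooth_Ds
  | |- smooth _ (N) => exact: smooth_N
  | |- smooth _ (Ninv) => exact: smooth_Ninv
  | |- smooth _ (H) => exact: smooth_H
  | h : jsmooth _ _ ?P |- smooth _ ?P => exact: js_smooth h
  | h : smooth _ ?P |- smooth _ ?P => exact: h
  end.

Lemma eqm_Ds2D p q s i j P Q : smooth A P -> smooth A Q ->
  eqm p q s (Ds i (Ds j (P + Q))) (Ds i (Ds j P) + Ds i (Ds j Q)).
Proof.
move=> sP sQ; apply: eqmod_eq => z Az.
have E := der_ext (Dtot_derivation c (sp i)) (derD (Dtot_derivation c (sp j)) sP sQ).
by rewrite [LHS]E // (derD (Dtot_derivation c _)) //; exact: smooth_Ds.
Qed.

(** Terms in which a derivative falls on n contain at most one derivative of W. *)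
Lemma eqm_Ds2M i j n W : js 0 0 0 n -> js 0 1 2 W ->
  eqm 2 2 3 (Ds i (Ds j (n * W))) (n * Ds i (Ds j W)).
Proof.
move=> hn hW; have e1 : eqm 1 1 2 (Ds j (n * W)) (n * Ds j W).
  apply: eqmod_derM (Dtot_derivation c _) _ _ _; sm.
  by apply: jsmoothM; [exact: jsW (js_Ds _ hn) _ _ _|exact: jsW hW _ _ _].
have {}e1 := @eqm_Ds _ _ _ i _ _ _ e1; apply: eqmod_trans (e1 _) _; first by sm.
apply: eqmod_derM (Dtot_derivation c _) _ _ _; sm; apply: jsmoothM.
  exact: jsW (js_Ds _ hn) _ _ _.
exact: jsW (js_Ds _ hW) _ _ _.
Qed.

(** Bounds one lower in K and N than in [eqm_Ds2M], because a time derivative will follow. They hold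
    since derivatives of N^2 are of order zero in K. *)
Lemma eqm_Ds2_lapse2_H i j : eqm 2 1 2 (Ds i (Ds j (N ^+ 2 * H))) (N ^+ 2 * Ds i (Ds j H)).
Proof.
have e1 : eqm 1 0 1 (Ds j (N ^+ 2 * H)) (N ^+ 2 * Ds j H).
  apply: eqmod_derM (Dtot_derivation c _) _ _ _; sm.
  by apply: jsmoothM; [exact: js_DN2|exact: js_H].
have {}e1 := @eqm_Ds _ _ _ i _ _ _ e1; apply: eqmod_trans (e1 _) _; first by sm.
apply: eqmod_derM (Dtot_derivation c _) _ _ _; sm; apply: jsmoothM.
  exact: js_DN2.
by js beta_smooth.
Qed.

(** The time derivative passes the two spatial derivatives one at a time, each exchange costing a
    commutator. *)
Lemma eqm_Ds2_hat0 i j Q : js 0 0 1 Q ->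
  eqm 2 2 3 (Ds i (Ds j (hat0 Q))) (hat0 (Ds i (Ds j Q))).
Proof.
move=> hQ.
have e1 : eqm 1 1 2 (hat0 (Ds j Q)) (Ds j (hat0 Q)).
  exact: (js_commutator beta_smooth).
have e2 := eqm_Ds i (smooth_Ds j (smooth_hat0 (js_smooth hQ))) e1.
apply: eqmod_trans (eqmod_sym e2) _; apply: eqmod_sym.
by apply: (js_commutator beta_smooth) => //; exact: js_Ds.
Qed.

Lemma eqm_hess i j Y : js 0 1 2 Y -> eqm 2 2 3 (hess Y i j) (Ds i (Ds j Y)).
Proof.
move=> hY; apply: eqmod_subr; apply: jsmooth_sum => k _; apply: jsmoothM.
  exact: js_Gam.
exact: jsW (js_Ds _ hY) _ _ _.
Qed.

(* Both halves of C_ij agree with [mid] up to orders (2, 2, 3). *)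
Lemma js_Ct i j : js 2 2 3 (Ct beta i j).
Proof.
set X := hat0 N; have hX : js 0 0 1 X by exact: (js_hat0N beta_smooth).
have hH : js 0 0 1 H by exact: js_H.
pose DD P := Ds i (Ds j P).
pose mid : jf R := Ninv * hat0 (DD X) + N * hat0 (DD H).
suff [e1 e2] : eqm 2 2 3 (hess (hat0 (Ninv * X) + N * hat0 H) i j) mid /\
    eqm 2 2 3 (hat2 beta (fun i' j' => Ninv * hess (X + N ^+ 2 * H) i' j') i j) mid.
  exact: (eqmod_trans e1 (eqmod_sym e2)).
split.
- apply: eqmod_trans (eqm_hess _ _ _) _; first by js beta_smooth.
  (* What is dropped is a product of first derivatives of N; two spatial derivatives bring it to
     order 3 in N. *)
  have e : eqm 0 0 1 (hat0 (Ninv * X) + N * hat0 H) (Ninv * hat0 X + N * hat0 H).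
    apply: eqmodD (eqmod_refl _ _ _).
    apply: eqmod_derM (hat0_derivation c _) _ _ _; sm.
    by apply: jsmoothM => //; exact: js_hat0Ninv.
  have {}e := @eqm_Ds _ _ _ i _ _ _ (@eqm_Ds _ _ _ j _ _ _ e).
  apply: eqmod_trans (e _ _) _; [by sm|by sm|].
  apply: eqmod_trans (eqm_Ds2D _ _ _ _ _ _ _) _; [by sm|by sm|].
  apply: eqmodD.
    apply: eqmod_trans (eqm_Ds2M _ _ _ _) _; [exact: js_Ninv|by js beta_smooth|].
    by apply: eqmodM; [exact: js_Ninv|exact: eqm_Ds2_hat0].
  apply: eqmod_trans (eqm_Ds2M _ _ _ _) _; [exact: js_N|by js beta_smooth|].
  by apply: eqmodM; [exact: js_N|exact: eqm_Ds2_hat0].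
- have hXH : js 0 0 1 (X + N ^+ 2 * H) by js beta_smooth.
  rewrite hat2E; apply: eqmod_trans (eqmod_subr _ _) _.
    apply: (js_hat2_zero beta_smooth (T := fun i' j' => Ninv * hess (X + N ^+ 2 * H) i' j')).
    by move=> i' j'; apply: jsmoothM; [exact: js_Ninv|exact: js_hess hXH].
  (* Bounds one below the target in K and N leave room for the time derivative, which does not raise
     the bound 2 in g. *)
  have e : eqm 2 1 2 (Ninv * hess (X + N ^+ 2 * H) i j) (Ninv * DD X + N * DD H).
    apply: (@eqmod_trans _ _ _ _ _ (Ninv * (DD X + N ^+ 2 * DD H))); last first.
      apply: eqmod_eq => z Az; rewrite !jE mulrDr; congr (_ + _).
      by rewrite /Ninv expr2 !jE; field; exact: N_neq0 Az.
    apply: eqmodM; first exact: js_Ninv.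
    apply: eqmod_trans (eqmod_subr _ _) _.
      apply: jsmooth_sum => k _; apply: jsmoothM; first exact: js_Gam.
      by apply: jsW (js_Ds _ hXH) _ _ _.
    apply: eqmod_trans (eqm_Ds2D _ _ _ _ _ _ _) _; [by sm|by sm|].
    by apply: eqmodD (eqmod_refl _ _ _) _; exact: eqm_Ds2_lapse2_H.
  have {}e := @eqm_hat0 _ _ _ _ _ _ _ _ e.
  apply: eqmod_trans (e _ _ _) _; [by rewrite /DD; sm|by []|by []|].
  apply: eqmod_trans (eqmod_derD _ (hat0_derivation c _) _ _) _;
    [by rewrite /DD; sm|by rewrite /DD; sm|].
  apply: eqmodD; apply: eqmod_derM (hat0_derivation c _) _ _ _; rewrite /DD; sm; apply: jsmoothM.
  + exact: js_hat0Ninv.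
  + exact: jsW (js_Ds _ (js_Ds _ hX)) _ _ _.
  + by js beta_smooth.
  + exact: jsW (js_Ds _ (js_Ds _ hH)) _ _ _.
Qed.

Lemma js_fK i j : js 2 2 3 (fK beta F i j).
Proof.
rewrite /fK; apply/jsmoothN/jsmoothM; first exact: js_Ninv.
apply: jsmoothD (js_Ct _ _); apply: jsmoothD (js_hessF F_smooth _ _).
apply: jsmoothD.
  apply: jsmoothM; first by js beta_smooth.
  exact: jsW (js_Box2 beta_smooth _ _) _ _ _.
by apply: (js_hat2 beta_smooth) => // k l; exact: js_Jt.
Qed.

End Curvature.

(** * Principal parts *)

Section Principal.
Variables (R : realType) (M : manifold3 R) (c : chart M).
Variables (beta : 'rV[R]_4 -> 'rV[R]_3) (F : @source_arg R -> R).
Hypothesis beta_smooth : forall k, smooth_on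
  [set x : 'rV[R]_4 | spatial_image c (spat x)] (fun x => beta x 0 k).
Hypothesis F_smooth : smooth_on
  [set a : @source_arg R | let: (x, N, g, K, q) := a in
     [/\ spatial_image c (spat x), 0 < N & posdef g]] F.
Local Notation A := (@admissible R M c).
Local Notation js p q s := (jsmooth A (orders p q s)).
Local Notation eqm p q s := (eqmod A (orders p q s)).
Local Notation N := (N (R := R)).
Local Notation Ninv := (Ninv (R := R)).
Local Notation hat0 := (hat0 beta).
Local Notation nu := (nu beta).
Implicit Types (P Q n : jf R) (p q s : nat).

(** Extended by zero to the time index, so that both parts of the wave operator are sums over the
    same index set. *)
Definition spatial_gu (d e : 'I_4) : jf R :=
  match unlift ord0 d, unlift ord0 e with
  | Some k, Some l => gu k l
  | _, _ => 0
  end.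

(** The inverse spacetime metric in coordinates. *)
Definition wave_coef (d e : 'I_4) : jf R :=
  - (Ninv * (Ninv * nu d * nu e)) + spatial_gu d e.

Lemma sum_spatial_gu (f : 'I_4 -> 'I_4 -> jf R) :
  \sum_d \sum_e spatial_gu d e * f d e = \sum_k \sum_l gu k l * f (sp k) (sp l).
Proof.
rewrite big_ord_recl big1 ?add0r => [|e _]; last first.
  by rewrite /spatial_gu unlift_none mul0r.
apply: eq_bigr => k _; rewrite big_ord_recl /spatial_gu liftK unlift_none mul0r add0r.
by apply: eq_bigr => l _; rewrite liftK.
Qed.

Lemma js_wave_coef d e : js 0 0 0 (wave_coef d e).
Proof.
apply: jsmoothD.
  by apply/jsmoothN/jsmoothM; [|apply: jsmoothM; [apply: jsmoothM|]];
    do ?[exact: js_Ninv | exact: (js_nu beta_smooth)].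
rewrite /spatial_gu; case: unliftP => [k _|_]; last exact: jsmooth_cst.
by case: unliftP => [l _|_]; [exact: js_gu|exact: jsmooth_cst].
Qed.

Lemma smooth_jvar u a : smooth A (jvar u a).
Proof. by exists (fun=> mdeg a); exact: jsmooth_jvar. Qed.

Lemma smooth_nu d : smooth A (nu d).
Proof. by exists (fun=> 0%N); exact: (js_nu beta_smooth). Qed.

Lemma js_hat0_nu r d : jsmooth A r (hat0 (nu d)).
Proof.
rewrite /nu; case: unliftP => [k _|_].
  apply: (jsmooth_ext (jsmoothN (js_hat0_bet beta_smooth r k))) => z Az.
  rewrite (derN (hat0_derivation c _)) //.
  by exists (fun=> 0%N); exact: (js_bet beta_smooth).
by apply: (jsmooth_ext (jsmooth_cst A r 0)) => z Az; rewrite (der_cst (hat0_derivation c _)).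
Qed.

Lemma hat0_term r n u a : ~~ is_g u -> smooth A n -> jsmooth A r (hat0 n) ->
  jsmooth A r (jvar u a) ->
  eqmod A r (hat0 (n * jvar u a)) (\sum_d (n * nu d) * jvar u (mincr d a)).
Proof.
move=> ug sn hn ha; apply: eqmod_trans (eqmod_derM (hat0_derivation c _) _ _ _) _ => //.
- exact: smooth_jvar.
- exact: jsmoothM.
- rewrite hat0_jvar // mulr_sumr; apply: eqmod_eq => z _; congr (_ z).
  by apply: eq_bigr => d _; rewrite mulrA.
Qed.

Lemma hat0_sum r (I : eqType) (l : seq I) (f g : I -> jf R) :
  (forall i, smooth A (f i)) -> (forall i, eqmod A r (hat0 (f i)) (g i)) ->
  eqmod A r (hat0 (\sum_(i <- l) f i)) (\sum_(i <- l) g i).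
Proof.
move=> sf fg; apply: eqmod_trans (eqmod_sum _ fg).
by apply: eqmod_eq => z Az; rewrite (der_sum (hat0_derivation c _)) // jsumE.
Qed.

Definition wave2 u : jf R :=
  \sum_d \sum_e wave_coef d e * jvar u (mincr e (mincr d midx0)).

Definition wave3 u : jf R := \sum_d \sum_e \sum_f
  (wave_coef d e * nu f) * jvar u (mincr f (mincr e (mincr d midx0))).

Lemma smooth_wave2 u : smooth A (wave2 u).
Proof.
apply: smooth_sum => d; apply: smooth_sum => e; apply: smoothM.
  exact: js_smooth (js_wave_coef d e).
exact: smooth_jvar.
Qed.

(** The parameter k is the order allowed in K: 0 when u is N, 1 when u is a component of K. Order 1
    in N is always present, from differentiating N^-1. *)
Lemma wave2_lead k u : ~~ is_g u -> (forall d, js 0 k 1 (jvar u (mincr d midx0))) ->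
  eqm 0 k 1 (- (Ninv * hat0 (Ninv * hat0 (jvar u midx0)))
     + \sum_k \sum_l gu k l * Ds k (Ds l (jvar u midx0))) (wave2 u).
Proof.
move=> ug hu.
have sN := js_smooth (js_Ninv c 0 0 0).
apply: (@eqmod_trans _ _ _ _ _ (- (Ninv * \sum_d \sum_e (Ninv * nu d * nu e)
    * jvar u (mincr e (mincr d midx0)))
    + \sum_d \sum_e spatial_gu d e * jvar u (mincr e (mincr d midx0)))).
  apply: eqmodD.
    apply/eqmodN/eqmodM; first exact: js_Ninv.
    rewrite hat0_jvar // mulr_sumr; apply: hat0_sum => d.
      by apply: smoothM => //; apply: smoothM; [exact: smooth_nu|exact: smooth_jvar].
    rewrite mulrA; apply: hat0_term => //; first by apply: smoothM => //; exact: smooth_nu.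
    have h : js 0 k 1 (hat0 Ninv * nu d + Ninv * hat0 (nu d)).
      apply: jsmoothD; apply: jsmoothM; [|exact: (js_nu beta_smooth)| |exact: js_hat0_nu].
        exact: (js_hat0Ninv beta_smooth).
      exact: js_Ninv.
    apply: (jsmooth_ext h) => z Az.
    by rewrite (derM (hat0_derivation c _)) //; exact: smooth_nu.
  rewrite sum_spatial_gu; apply: eqmod_eq => z _; congr (_ z).
  apply: eq_bigr => i _; apply: eq_bigr => l _.
  by rewrite /Ds !Dtot_jvar mincrC.
apply: eqmod_eq => z _; congr (_ z); rewrite mulr_sumr -sumrN -big_split /=.
apply: eq_bigr => d _; rewrite mulr_sumr -sumrN -big_split /=.
apply: eq_bigr => e _; rewrite /wave_coef mulrDl; congr (_ + _).
by rewrite !mulrA mulNr.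
Qed.

Lemma wave3_lead q s u : ~~ is_g u ->
  (forall d e, js 0 q.+1 s.+1 (jvar u (mincr e (mincr d midx0)))) ->
  eqm 0 q.+1 s.+1 (hat0 (wave2 u)) (wave3 u).
Proof.
move=> ug hu; have sw d e := js_smooth (js_wave_coef d e).
apply: hat0_sum => d.
  by apply: smooth_sum => e; apply: smoothM => //; exact: smooth_jvar.
apply: hat0_sum => e; first by apply: smoothM => //; exact: smooth_jvar.
apply: hat0_term => //.
by apply: jsW (js_hat0 beta_smooth (js_wave_coef d e) _ _) _ _ _.
Qed.

Lemma eqmW p q s p' q' s' P Q : eqm p q s P Q -> (p <= p')%N -> (q <= q')%N ->
  (s <= s')%N -> eqm p' q' s' P Q.
Proof. exact: jsW. Qed.

Lemma eq_N_lead : eqm 1 1 2 (eq_N beta F) (wave3 UN).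
Proof.
apply: eqmod_trans (eqmod_subr _ _) _.
  by apply: jsW (js_hat0 beta_smooth (js_Fj F_smooth 0 0 0) _ _) _ _ _.
have h1 : eqm 1 0 1 (Box0 beta N) (wave2 UN).
  apply: (@eqmod_trans _ _ _ _ _ (- (Ninv * hat0 (Ninv * hat0 N))
     + \sum_k \sum_l gu k l * Ds k (Ds l N))).
    apply: eqmodD; first exact: eqmod_refl.
    apply: eqmod_sum => k; apply: eqmod_sum => l; apply: eqmodM; first exact: js_gu.
    by apply: eqmod_subr; js beta_smooth.
  apply: eqmW (wave2_lead (k := 0) _ _) _ _ _ => //.
  by move=> d; apply: jsmooth_jvar; rewrite mdeg_mincr mdeg0.
apply: eqmod_trans (eqm_hat0 beta_smooth (smooth_wave2 UN) _ _ h1) _ => //.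
apply: eqmW (wave3_lead (q := 0) (s := 1) _ _) _ _ _ => //.
by move=> d e; apply: jsmooth_jvar; rewrite !mdeg_mincr mdeg0.
Qed.

Lemma eq_K_lead i j : eqm 2 2 3 (eq_K beta F i j) (wave3 (UK (sidx i j))).
Proof.
apply: eqmod_trans (eqmod_subr _ _) _; first exact: (js_fK beta_smooth F_smooth).
rewrite hat2E; apply: eqmod_trans (eqmod_subr _ _) _.
  apply: (js_hat2_zero beta_smooth) => k l.
  exact: jsW (js_Box2 beta_smooth _ _) _ _ _.
have sK k l : smooth A (Kd k l) by exact: smooth_jvar.
have sN := js_smooth (js_Ninv c 0 0 0).
(* Order 2 in g comes from derivatives of the Christoffel symbols, and the outer time derivative
   does not raise it. *)
have h1 : eqm 2 1 2 (Box2 beta (@Kd R) i j) (wave2 (UK (sidx i j))).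
  apply: (@eqmod_trans _ _ _ _ _ (- (Ninv * hat0 (Ninv * hat0 (Kd i j)))
     + \sum_k \sum_l gu k l * Ds k (Ds l (Kd i j)))).
    apply: eqmodD.
      apply/eqmodN/eqmodM; first exact: js_Ninv.
      rewrite hat2E; apply: eqmod_trans (eqmod_subr _ _) _.
        apply: (js_hat2_zero beta_smooth (T := fun i' j' => Ninv * hat2 beta (@Kd R) i' j')).
        move=> k l; apply: jsW (_ : js 0 1 1 _) _ _ _ => //.
        by js beta_smooth.
      apply: eqmW (eqm_hat0 beta_smooth _ _ _ (_ : eqm 0 0 0 _ _)) _ _ _ => //.
        by apply: smoothM => //; exact: (smooth_hat0 beta_smooth).
      apply: eqmodM; first exact: js_Ninv.
      rewrite hat2E; apply: eqmod_subr; apply: (js_hat2_zero beta_smooth) => k l.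
      exact: js_Kd.
    apply: eqmod_sum => k; apply: eqmod_sum => l; apply: eqmodM; first exact: js_gu.
    (* The three Christoffel sums of the outer covariant derivative are discarded, and below, under
       a spatial derivative, the two of the inner one. *)
    apply: eqmod_trans (eqmod_subr _ _) _; first by js beta_smooth.
    apply: eqmod_trans (eqmod_subr _ _) _; first by js beta_smooth.
    apply: eqmod_trans (eqmod_subr _ _) _; first by js beta_smooth.
    apply: eqmW (eqm_Ds _ (smooth_Ds _ (sK _ _)) (_ : eqm 1 0 1 _ _)) _ _ _ => //.
    apply: eqmod_trans (eqmod_subr _ _) _; first by js beta_smooth.
    by apply: eqmod_subr; js beta_smooth.
  apply: eqmW (wave2_lead (k := 1) _ _) _ _ _ => //.
  by move=> d; apply: jsmooth_jvar; rewrite mdeg_mincr mdeg0.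
apply: eqmod_trans (eqm_hat0 beta_smooth (smooth_wave2 _) _ _ h1) _ => //.
apply: eqmW (wave3_lead (q := 1) (s := 1) _ _) _ _ _ => //.
by move=> d e; apply: jsmooth_jvar; rewrite !mdeg_mincr mdeg0.
Qed.

Lemma eq_g_lead i j : eqm 0 0 1 (eq_g beta i j)
  (\sum_d nu d * jvar (Ug (sidx i j)) (mincr d midx0)).
Proof.
pose Z : jf R := - \sum_k (Ds i (bet beta k) * gd k j + Ds j (bet beta k) * gd i k)
  + 2%:R *: (N * Kd i j).
apply: (@jsmooth_ext _ _ _ _ Z).
  apply: jsmoothD; last by js beta_smooth.
  by apply/jsmoothN/(js_hat2_zero beta_smooth) => k l; exact: js_gd.
move=> z _; congr (_ z); rewrite /Z /eq_g sum_nu Dtot_jvar [RHS]addrAC; congr (_ + _).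
rewrite opprD addrA [X in _ = X - _]addrAC subrr add0r -opprD -/(Lie2 _ _ _ _); congr (- _).
rewrite /Lie2 -big_split /=; apply: eq_bigr => k _.
by rewrite /Ds Dtot_jvar mulNr addrC -addrA addKr.
Qed.

End Principal.

(** * Sums over multi-indices of fixed length and monomials *)

Section SumDeg.
Variable R : realType.

Lemma mdeg_ge (a : midx) i : (a i <= mdeg a)%N.
Proof. by rewrite /mdeg (bigD1 i) //= leq_addr. Qed.

(** Principal parts arise as sums over tuples of indices; tuples with the same multi-index are
    gathered into one coefficient. *)
Lemma sum_deg_family (I : finType) (mu : I -> midx) (d : nat) (t : I -> R)
    (f : midx -> R) : (forall i, mdeg (mu i) = d) ->
  sum_deg d%:Z (fun al => (\sum_(i | mu i == al) t i) * f al)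
  = \sum_i t i * f (mu i).
Proof.
move=> hmu; pose b i : {ffun 'I_4 -> 'I_d.+1} := [ffun j => inord (mu i j)].
pose nat_midx (a : {ffun 'I_4 -> 'I_d.+1}) : midx := [ffun i => nat_of_ord (a i)].
(* Each component of a multi-index of length d is at most d, so [inord] is exact. *)
have bK i : nat_midx (b i) = mu i.
  by apply/ffunP => j; rewrite !ffunE inordK // ltnS -(hmu i) mdeg_ge.
rewrite /sum_deg (partition_big b (fun a => (mdeg (nat_midx a))%:Z == d)) /=; last first.
  by move=> i _; rewrite bK hmu.
apply: eq_bigr => a _; rewrite mulr_suml.
apply: eq_big => [i|i /eqP ->] //; rewrite -/(nat_midx a).
apply/eqP/eqP => [E|<-]; last by rewrite bK.
by apply/ffunP => j; rewrite ffunE E ffunE inord_val.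
Qed.

Lemma sum_deg0 d (f : midx -> R) : (forall al, f al = 0) -> sum_deg d f = 0.
Proof. by move=> f0; rewrite /sum_deg big1. Qed.

Lemma sum_deg_eq d (f g : midx -> R) : f =1 g -> sum_deg d f = sum_deg d g.
Proof. by move=> fg; apply: eq_bigr => a _; exact: fg. Qed.

Definition monomial (xi : 'rV[R]_4) (a : midx) : R := \prod_i xi 0 i ^+ a i.

Lemma monomial0 xi : monomial xi midx0 = 1.
Proof. by rewrite /monomial big1 // => i _; rewrite ffunE. Qed.

Lemma monomial_mincr xi d a : monomial xi (mincr d a) = monomial xi a * xi 0 d.
Proof.
rewrite /monomial; under eq_bigr do rewrite ffunE exprD.
rewrite big_split /=; congr (_ * _).
rewrite (bigD1 d) //= eqxx expr1 big1 ?mulr1 // => i /negPf.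
by rewrite eq_sym => ->.
Qed.

End SumDeg.

(** * Strict hyperbolicity *)

Section Cone.
Variables (R : realType).
Implicit Types (h : 'M[R]_3) (b : 'rV[R]_4) (tau xi : 'rV[R]_4).

Definition polar h (v w : 'rV[R]_3) : R :=
  \sum_i \sum_j h i j * (v 0 i * w 0 j + w 0 i * v 0 j).

Lemma quadfD h v w s t : quadf h (s *: v + t *: w)
  = s ^+ 2 * quadf h v + s * t * polar h v w + t ^+ 2 * quadf h w.
Proof.
rewrite /quadf /polar !mulr_sumr -!big_split /=; apply: eq_bigr => i _.
rewrite !mulr_sumr -!big_split /=; apply: eq_bigr => j _; rewrite !mxE; ring.
Qed.

Definition linf b tau : R := \sum_d b 0 d * tau 0 d.

Lemma linfD b v w s t : linf b (s *: v + t *: w) = s * linf b v + t * linf b w.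
Proof.
rewrite /linf !mulr_sumr -big_split; apply: eq_bigr => d _ /=; rewrite !mxE; ring.
Qed.

Variables (h : 'M[R]_3) (b : 'rV[R]_4) (k : R).
Hypotheses (hpos : posdef h) (b0 : b 0 ord0 = 1) (kpos : 0 < k).

(** With b = nu, k = N^-1 and h the inverse of g, this is the symbol of the wave operator. *)
Definition lorentz tau : R := - (k * linf b tau) ^+ 2 + quadf h (spat tau).

Definition time_cone : set 'rV[R]_4 := [set tau | 0 < linf b tau /\ lorentz tau < 0].

Lemma spatD v w (s t : R) : spat (s *: v + t *: w) = s *: spat v + t *: spat w.
Proof. by apply/rowP => i; rewrite !mxE. Qed.

Lemma lorentzD v w s t : lorentz (s *: v + t *: w)
  = s ^+ 2 * lorentz v + t ^+ 2 * lorentz w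
    + s * t * (polar h (spat v) (spat w) - 2 * k ^+ 2 * linf b v * linf b w).
Proof. by rewrite /lorentz linfD spatD quadfD; ring. Qed.

Lemma linf_continuous : continuous (linf b).
Proof.
apply: (continuous_fun_sum (F := fun d tau => b 0 d * tau 0 d)) => d.
apply: continuous_fun_mul; last exact: entry_continuous.
by move=> x; exact: cst_continuous.
Qed.

Lemma lorentz_continuous : continuous lorentz.
Proof.
have cq : continuous (fun tau => quadf h (spat tau)).
  rewrite /quadf.
  apply: (continuous_fun_sum (F := fun i tau => \sum_j h i j * (spat tau 0 i * spat tau 0 j))) => i.
  apply: (continuous_fun_sum (F := fun j tau => h i j * (spat tau 0 i * spat tau 0 j))) => j.
  have cs l : continuous (fun tau => spat tau 0 l).
    by under eq_fun do rewrite mxE; exact: entry_continuous.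
  apply: continuous_fun_mul; first by move=> ?; exact: cst_continuous.
  exact: continuous_fun_mul.
have ck : continuous (fun tau => k * linf b tau).
  by apply: continuous_fun_mul linf_continuous => y; exact: cst_continuous.
have ck2 := continuous_fun_mul ck ck.
by move=> x; exact: (continuousD (continuousN (ck2 x)) (cq x)).
Qed.

Lemma time_cone_nonempty : time_cone !=set0.
Proof.
(* The covector dt: its spatial part vanishes and L takes the value 1. *)
exists (delta_mx 0 ord0).
have l1 : linf b (delta_mx 0 ord0) = 1.
  rewrite /linf (bigD1 ord0) //= big1 ?addr0 ?mxE ?b0 ?eqxx ?mulr1 // => i /negPf i0.
  by rewrite mxE i0 andbF mulr0.
split; first by rewrite l1.
rewrite /lorentz l1 mulr1 (_ : quadf _ _ = 0); first by rewrite addr0 oppr_lt0 exprn_gt0.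
by rewrite /quadf big1 // => i _; rewrite big1 // => j _; rewrite !mxE !mul0r mulr0.
Qed.

Lemma time_cone_open : open time_cone.
Proof.
rewrite (_ : time_cone = (linf b @^-1` [set x | 0 < x]) `&` (lorentz @^-1` [set x | x < 0])) //.
apply: openI; apply: open_comp; first by move=> x _; exact: linf_continuous.
- exact: open_gt.
- by move=> x _; exact: lorentz_continuous.
- exact: open_lt.
Qed.

Lemma quadf_ge0 v : 0 <= quadf h v.
Proof.
have [->|v0] := eqVneq v 0; last by rewrite -quadfE; exact/ltW/hpos.
by rewrite -(scale0r (0 : 'rV[R]_3)) quadfZ expr0n mul0r.
Qed.

(* Nonnegativity of [quadf h] at [L w v - L v w] bounds the polar form and
   replaces the reversed Cauchy-Schwarz inequality. *)
Lemma time_cone_combination v w s t : time_cone v -> time_cone w ->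
  0 < s -> 0 < t -> time_cone (s *: v + t *: w).
Proof.
move=> [lv qv] [lw qw] s0 t0; split.
  by rewrite linfD addr_gt0 // mulr_gt0.
have := quadf_ge0 (linf b w *: spat v + (- linf b v) *: spat w).
rewrite lorentzD quadfD; move: qv qw; rewrite /lorentz.
move: lv lw; set lv := linf b v; set lw := linf b w; set P := polar _ _ _.
set qv := quadf h (spat v); set qw := quadf h (spat w) => lv0 lw0 qv0 qw0 hP.
have hv : lw ^+ 2 * qv < lw ^+ 2 * (k * lv) ^+ 2.
  by rewrite ltr_pM2l ?exprn_gt0 //; lra.
have hw : lv ^+ 2 * qw < lv ^+ 2 * (k * lw) ^+ 2.
  by rewrite ltr_pM2l ?exprn_gt0 //; lra.
(* Nonnegativity bounds lv lw P by lw^2 qv + lv^2 qw, and [hv] and [hw] bound this strictly;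
   division by lv lw > 0 follows. *)
have hlP : lv * lw * P < lv * lw * (2 * k ^+ 2 * lv * lw).
  rewrite [X in _ < X](_ : _ = lw ^+ 2 * (k * lv) ^+ 2 + lv ^+ 2 * (k * lw) ^+ 2).
    apply: le_lt_trans (ltrD hv hw); rewrite -subr_ge0.
    by rewrite (_ : _ - _ = lw ^+ 2 * qv + lw * - lv * P + (- lv) ^+ 2 * qw) //; ring.
  by ring.
have {hlP} hP' : P < 2 * k ^+ 2 * lv * lw by move: hlP; rewrite ltr_pM2l // mulr_gt0.
have h1 : s ^+ 2 * (- (k * lv) ^+ 2 + qv) < 0 by rewrite pmulr_rlt0 // exprn_gt0.
have h2 : t ^+ 2 * (- (k * lw) ^+ 2 + qw) < 0 by rewrite pmulr_rlt0 // exprn_gt0.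
have h3 : s * t * (P - 2 * k ^+ 2 * lv * lw) < 0.
  by rewrite pmulr_rlt0 ?mulr_gt0 // subr_lt0.
by lra.
Qed.

Lemma time_cone_convex : @convex_set R 'rV[R]_4 time_cone.
Proof.
apply/convex_setW => v w /set_mem hv /set_mem hw l l0 l1.
apply/mem_set; rewrite /conv /=.
by apply: time_cone_combination => //=; rewrite subr_gt0.
Qed.

Lemma linfZ s tau : linf b (s *: tau) = s * linf b tau.
Proof. by have := linfD b tau 0 s 0; rewrite scaler0 addr0 mul0r addr0. Qed.

Lemma lorentzZ s tau : lorentz (s *: tau) = s ^+ 2 * lorentz tau.
Proof.
have := lorentzD tau 0 s 0; rewrite scaler0 addr0 => ->.
by rewrite expr0n mulr0 !mul0r !addr0.
Qed.

Lemma time_cone_scale s tau : 0 < s -> time_cone tau -> time_cone (s *: tau).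
Proof.
move=> s0 [lt qt]; split; first by rewrite linfZ mulr_gt0.
by rewrite lorentzZ pmulr_rlt0 // exprn_gt0.
Qed.

Lemma linf_hyperbolic : strict_hyperbolicity_cone 1 (linf b) time_cone.
Proof.
split; [exact: time_cone_nonempty|exact: time_cone_open|exact: time_cone_convex|
  exact: time_cone_scale|].
move=> tau [lt _] xi _; exists [:: - linf b xi / linf b tau]; split=> // l.
have := linfD b xi tau 1 l; rewrite scale1r mul1r => ->.
rewrite inE; have l0 := lt0r_neq0 lt; split.
  move=> E; apply/eqP; apply: (mulIf l0); rewrite mulfVK //; lra.
by move=> /eqP ->; rewrite mulfVK // addrN.
Qed.

(** Opposite signs of the leading and constant coefficients make the discriminant positive; the
    product of the roots is q / a, so neither vanishes. *)
Lemma quadratic_factor (a p q : R) : a < 0 -> 0 < q ->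
  exists r1 r2, [/\ r1 != r2, r1 != 0, r2 != 0 &
    forall x, q + x * p + x ^+ 2 * a = a * ((x - r1) * (x - r2))].
Proof.
move=> a0 q0; have ane0 := ltr0_neq0 a0.
have d0 : 0 < p ^+ 2 - 4 * a * q.
  have : 0 <= p ^+ 2 by exact: sqr_ge0.
  have : a * q < 0 by rewrite nmulr_rlt0.
  lra.
set d := p ^+ 2 - _ in d0; pose s := Num.sqrt d.
have s0 : 0 < s by rewrite sqrtr_gt0.
have ss : s ^+ 2 = d by rewrite sqr_sqrtr // ltW.
pose r1 := (- p + s) / (2 * a); pose r2 := (- p - s) / (2 * a).
have F x : q + x * p + x ^+ 2 * a = a * ((x - r1) * (x - r2)).
  rewrite /r1 /r2.
  (* Expressing q through p, s and a leaves a rational identity free of square roots. *)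
  have -> : q = (p ^+ 2 - s ^+ 2) / (4 * a) by rewrite ss /d; field.
  by field.
have rr : r1 * r2 != 0.
  have := F 0; rewrite mul0r expr0n mul0r !addr0 !sub0r mulrNN => E.
  by apply: contraTneq q0 => r0; rewrite E r0 mulr0 ltxx.
exists r1, r2; split=> //.
- rewrite -subr_eq0 (_ : r1 - r2 = s / a); last by rewrite /r1 /r2; field.
  by rewrite mulf_neq0 ?invr_neq0 // lt0r_neq0.
- by apply: contra_neq rr => ->; rewrite mul0r.
- by apply: contra_neq rr => ->; rewrite mulr0.
Qed.

Lemma linf_spat_eq0 tau : linf b tau = 0 -> spat tau = 0 -> tau = 0.
Proof.
move=> lt st; have ti i : tau 0 (sp i) = 0.
  by have /rowP/(_ i) := st; rewrite !mxE.
apply/rowP => d; rewrite mxE; case: (unliftP ord0 d) => [i ->|->]; first exact: ti.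
move: lt; rewrite /linf big_ord_recl b0 mul1r big1 ?addr0 // => i _.
by rewrite ti mulr0.
Qed.

Lemma wave_hyperbolic :
  strict_hyperbolicity_cone 3 (fun xi => linf b xi * lorentz xi) time_cone.
Proof.
split; [exact: time_cone_nonempty|exact: time_cone_open|exact: time_cone_convex|
  exact: time_cone_scale|].
move=> tau [lt qt] xi hxi; have l0 := lt0r_neq0 lt.
pose l := - linf b xi / linf b tau; pose eta := xi + l *: tau.
have leta : linf b eta = 0.
  have := linfD b xi tau 1 l; rewrite scale1r mul1r -/eta => ->.
  by rewrite /l mulfVK // addrN.
(* Otherwise eta would vanish and xi would be proportional to tau. *)
have seta : spat eta != 0.
  apply/eqP => s0; have e0 := linf_spat_eq0 leta s0.
  by apply: (hxi (- l)); apply/eqP; rewrite scaleNr -addr_eq0 -/eta e0.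
have qeta : 0 < lorentz eta.
  by rewrite /lorentz leta mulr0 expr0n oppr0 add0r -quadfE; exact: hpos.
have [r1 [r2 [r12 r10 r20 Fr]]] :=
  quadratic_factor (polar h (spat eta) (spat tau)) qt qeta.
exists [:: l; l + r1; l + r2]; split=> //.
  rewrite /= !inE negb_or -!(subr_eq0 l) !opprD !addrA subrr !add0r !oppr_eq0 r10 r20 /=.
  by rewrite andbT (inj_eq (addrI l)).
(* Based at eta, the line has parameter x - l, which is why the roots are l, l + r1 and l + r2. *)
move=> x; have -> : xi + x *: tau = 1 *: eta + (x - l) *: tau.
  by rewrite scale1r /eta -addrA -scalerDl [l + _]addrC subrK.
rewrite linfD lorentzD leta mulr0 add0r expr1n !mul1r mulr0 mul0r subr0.
rewrite [_ + (x - l) ^+ 2 * _ + _]addrAC Fr !inE.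
rewrite (rwP eqP) !mulf_eq0 (negPf l0) (negPf (ltr0_neq0 qt)) orbF /=.
rewrite -[x - l - r1]addrA -[x - l - r2]addrA -!opprD !subr_eq0.
by [].
Qed.

End Cone.

(** * The quasi-diagonal structure *)

Lemma sidxC i j : sidx i j = sidx j i.
Proof. by rewrite /sidx; case: ltngtP => // /val_inj ->. Qed.

Section QuasiDiagonal.
Variables (R : realType) (M : manifold3 R) (c : chart M).
Variables (beta : 'rV[R]_4 -> 'rV[R]_3) (F : @source_arg R -> R).
Hypothesis beta_smooth : forall k, smooth_on
  [set x : 'rV[R]_4 | spatial_image c (spat x)] (fun x => beta x 0 k).
Hypothesis F_smooth : smooth_on
  [set a : @source_arg R | let: (x, N, g, K, q) := a in
     [/\ spatial_image c (spat x), 0 < N & posdef g]] F.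
Local Notation A := (@admissible R M c).
Local Notation js p q s := (jsmooth A (orders p q s)).

Definition index_unknown (u : unknown) : int := if u is inr _ then 4 else 3.

Definition index_equation (u : unknown) : int :=
  match u with inl (inl _) => 2 | inl (inr _) => 0 | inr _ => 1 end.

Definition midx1 (d : 'I_4) : midx := mincr d midx0.
Definition midx3 (t : 'I_4 * 'I_4 * 'I_4) : midx :=
  mincr t.2 (mincr t.1.2 (mincr t.1.1 midx0)).

Definition transport_coef (al : midx) : jf R :=
  \sum_(d | midx1 d == al) nu beta d.

Definition wave3_coef (al : midx) : jf R :=
  \sum_(t | midx3 t == al) wave_coef beta t.1.1 t.1.2 * nu beta t.2.

Definition diag_coef (u : unknown) : midx -> jf R :=
  if is_g u then transport_coef else wave3_coef.

Definition principal_coef (e u : unknown) (al : midx) : jf R :=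
  if e == u then diag_coef e al else 0.

Definition diag_part (e : unknown) : jf R :=
  if is_g e then \sum_d nu beta d * jvar e (midx1 d) else wave3 beta e.

Lemma transport_coefE (f : midx -> R) z :
  sum_deg 1 (fun al => transport_coef al z * f al)
  = \sum_d nu beta d z * f (midx1 d).
Proof.
rewrite -(sum_deg_family (d := 1)); last by move=> d; rewrite mdeg_mincr mdeg0.
by apply: sum_deg_eq => al; rewrite /transport_coef jsumE.
Qed.

Lemma wave3_coefE (f : midx -> R) z :
  sum_deg 3 (fun al => wave3_coef al z * f al)
  = \sum_d \sum_e \sum_g wave_coef beta d e z * nu beta g z * f (midx3 (d, e, g)).
Proof.
transitivity (sum_deg 3 (fun al => (\sum_(t | midx3 t == al)
    (wave_coef beta t.1.1 t.1.2 * nu beta t.2) z) * f al)).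
  by apply: sum_deg_eq => al; rewrite /wave3_coef jsumE.
rewrite (sum_deg_family (d := 3)); last by move=> t; rewrite !mdeg_mincr mdeg0.
by rewrite !pair_bigA /=; apply: eq_bigr => -[[d e] g].
Qed.

Lemma diag_partE e z : sum_deg (index_unknown e - index_equation e)
  (fun al => diag_coef e al z * jvar e al z) = diag_part e z.
Proof.
case: e => [[p|p]|[]]; rewrite /diag_coef /diag_part /=.
- by rewrite transport_coefE jsumE.
- rewrite wave3_coefE /wave3 jsumE; apply: eq_bigr => d _; rewrite jsumE.
  by apply: eq_bigr => e _; rewrite jsumE.
- rewrite wave3_coefE /wave3 jsumE; apply: eq_bigr => d _; rewrite jsumE.
  by apply: eq_bigr => e _; rewrite jsumE.
Qed.

Lemma principal_partE e z : \sum_u sum_deg (index_unknown u - index_equation e)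
  (fun al => principal_coef e u al z * jvar u al z) = diag_part e z.
Proof.
rewrite (bigD1 e) //= big1 ?addr0; last first.
  move=> u ue; apply: sum_deg0 => al.
  by rewrite /principal_coef eq_sym (negPf ue) mul0r.
by rewrite -diag_partE /principal_coef eqxx.
Qed.

Lemma jsmooth_lower_order p q s (d : unknown -> int) (P : jf R) : js p q s P ->
  (forall u, ((orders p q s u)%:Z < d u)) -> lower_order A d P.
Proof.
move=> hP hd z z' Az Az' ez hz; apply: jsmooth_depend hP Az Az' ez _ => u a ha.
by apply: hz; apply: le_lt_trans (hd u); rewrite lez_nat.
Qed.

Lemma principal_coef_lower e u al :
  lower_order A (fun u' => index_unknown u' - index_equation e) (principal_coef e u al).
Proof.
(* All differences m_u - n_e are at least 3 - 2 = 1, so order zero is low enough. *)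
apply: (@jsmooth_lower_order 0 0 0); last by case: e => [[p|p]|[]] [[v|v]|[]].
rewrite /principal_coef; case: ifP => _; last exact: jsmooth_cst.
rewrite /diag_coef; case: ifP => _; apply: jsmooth_sum => t _.
  exact: (js_nu beta_smooth).
by apply: jsmoothM; [exact: js_wave_coef|exact: (js_nu beta_smooth)].
Qed.

Lemma remainder_lower e :
  lower_order A (fun u => index_unknown u - index_equation e)
    (reduced_system beta F e - diag_part e).
Proof.
case: e => [[p|p]|[]]; rewrite /diag_part /=.
- apply: (@jsmooth_lower_order 0 0 1); last by case=> [[v|v]|[]].
  by have := eq_g_lead beta_smooth (val p).1 (val p).2; rewrite sidx_val.
- apply: (@jsmooth_lower_order 2 2 3); last by case=> [[v|v]|[]].
  by have := eq_K_lead beta_smooth F_smooth (val p).1 (val p).2; rewrite sidx_val.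
- apply: (@jsmooth_lower_order 1 1 2); last by case=> [[v|v]|[]].
  exact: (eq_N_lead beta_smooth F_smooth).
Qed.

Definition nu_row (z : jet R unknown) : 'rV[R]_4 := \row_d nu beta d z.

Lemma transport_symbol z xi :
  symbol 1 (fun al => transport_coef al z) xi = linf (nu_row z) xi.
Proof.
rewrite /symbol (transport_coefE (monomial xi)) /linf; apply: eq_bigr => d _.
by rewrite /midx1 monomial_mincr monomial0 mul1r mxE.
Qed.

Lemma wave_symbol z xi : symbol 3 (fun al => wave3_coef al z) xi
  = linf (nu_row z) xi * lorentz (invmx (gmx z)) (nu_row z) (Ninv z) xi.
Proof.
rewrite /symbol (wave3_coefE (monomial xi)).
(* The sum over the third index is L, which splits off from the quadratic symbol. *)
transitivity (\sum_d \sum_e wave_coef beta d e z * (xi 0 d * xi 0 e) * linf (nu_row z) xi).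
  apply: eq_bigr => d _; apply: eq_bigr => e _; rewrite /linf mulr_sumr.
  apply: eq_bigr => f _.
  by rewrite /midx3 /= !monomial_mincr monomial0 mxE; ring.
under eq_bigr do rewrite -mulr_suml.
rewrite -mulr_suml mulrC; congr (_ * _); rewrite /lorentz.
have -> : quadf (invmx (gmx z)) (spat xi)
    = \sum_d \sum_e spatial_gu d e z * (xi 0 d * xi 0 e).
  have := sum_spatial_gu (fun d e => (fun=> xi 0 d * xi 0 e) : jf R).
  move=> /(congr1 (fun P : jf R => P z)); rewrite /quadf !jsumE => E.
  transitivity (\sum_i (\sum_j gu i j * (fun=> xi 0 (sp i) * xi 0 (sp j)) : jf R) z).
    by apply: eq_bigr => i _; rewrite jsumE; apply: eq_bigr => j _; rewrite !mxE.
  by rewrite -E; apply: eq_bigr => d _; rewrite jsumE.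
rewrite exprMn expr2 /linf [X in _ = - (_ * X) + _]expr2 mulr_suml mulr_sumr -sumrN -big_split.
apply: eq_bigr => d _; rewrite /= mulr_sumr mulr_sumr -sumrN -big_split.
by apply: eq_bigr => e _; rewrite /= /wave_coef !jE !mxE; ring.
Qed.

Lemma quasi_diagonal_reduced :
  quasi_diagonal_with index_unknown index_equation A (reduced_system beta F).
Proof.
exists principal_coef, (fun e => reduced_system beta F e - diag_part e); split.
- by move=> e z _; rewrite principal_partE !jE addrC subrK.
- by move=> e u al _; exact: principal_coef_lower.
- exact: remainder_lower.
- by move=> e u al z eu _ _; rewrite /principal_coef (negPf eu).
- move=> z Az; have [_ N0 gpos] := Az.
  have gT : (gmx z)^T = gmx z.
    by apply/matrixP => i j; rewrite !mxE /gd sidxC.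
  have hpos := posdef_invmx gT gpos.
  have k0 : 0 < Ninv z by rewrite invr_gt0.
  have b0 : nu_row z 0 ord0 = 1 by rewrite mxE /nu unlift_none.
  set C := time_cone (invmx (gmx z)) (nu_row z) (Ninv z).
  exists (fun=> C), C; split=> //.
  + case=> [[p|p]|[]] /=; rewrite /principal_coef eqxx /diag_coef /=.
    * rewrite (_ : symbol _ _ = linf (nu_row z)); first exact: linf_hyperbolic.
      by apply/funext => xi; exact: transport_symbol.
    * rewrite (_ : symbol _ _ = fun xi => linf (nu_row z) xi
        * lorentz (invmx (gmx z)) (nu_row z) (Ninv z) xi).
        exact: wave_hyperbolic.
      by apply/funext => xi; exact: wave_symbol.
    * rewrite (_ : symbol _ _ = fun xi => linf (nu_row z) xi
        * lorentz (invmx (gmx z)) (nu_row z) (Ninv z) xi).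
        exact: wave_hyperbolic.
      by apply/funext => xi; exact: wave_symbol.
  + exact: time_cone_nonempty.
  + exact: time_cone_open.
  + by move=> u; exact: subset_refl.
Qed.

Lemma fK_order i j : order_at_most A fK_orders (fK beta F i j).
Proof.
move=> z z' Az Az' ez hz.
apply: (jsmooth_depend (js_fK beta_smooth F_smooth i j)) => // u a ha.
by apply: hz; case: u ha => [[p|p]|p].
Qed.

End QuasiDiagonal.

Theorem theorem3 (R : realType) (M : manifold3 R)
    (beta : chart M -> 'rV[R]_4 -> 'rV[R]_3)
    (F : chart M -> @source_arg R -> R)
    (hbeta : smooth_shift beta) (hF : smooth_source F) :
  (forall (c : chart M) (i j : 'I_3),
      order_at_most (admissible c) fK_orders (fK (beta c) (F c) i j))
  /\ quasi_diagonal_hyperbolic (fun c : chart M => admissible c)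
       (fun c : chart M => reduced_system (beta c) (F c)).
Proof.
have [hb _] := hbeta; have [hf _] := hF.
split=> [c i j|]; first exact: fK_order.
exists index_unknown, index_equation => c; exact: quasi_diagonal_reduced.
Qed.
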